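(* Let $P,T\ge 1$ be integers and let $X_1,X_2,\dots$ be i.i.d. random $P\times T$ real matrices with probability density $f:\mathbb{R}^{P,T}\to\mathbb{R}_+$ with respect to Lebesgue measure. Let $K:\mathbb{R}^{P,T}\to\mathbb{R}_+$ be an integrable kernel with $\int_{\mathbb{R}^{P,T}}K(X)\,dX=1$ and spherically symmetric in the sense that $\int_{\mathbb{R}^{P,T}}X\,K(X)\,dX=0$. For $h>0$ let $$\hat f(X;h)=\frac{1}{N h^{P\cdot T}}\sum_{n=1}^N K\big(h^{-1}(X-X_n)\big).$$ Assume: (i) $f$ is square integrable and twice differentiable, with all its second order partial derivatives bounded, continuous and square integrable; (ii) $K$ is square integrable, with finite second order moments satisfying $\int_{\mathbb{R}^{P,T}}\mathrm{vec}(X)\,\mathrm{vec}(X)^\top K(X)\,dX=m_2(K)\,\mathbb{I}_{P\cdot T}$, where $m_2(K)=\int_{\mathbb{R}^{P,T}}x_{p,t}^2K(X)\,dX$ for every $p=1,\dots,P$, $t=1,\dots,T$; (iii) the bandwidths $h=h_N$ form a positive sequence such that $h\to0$ and $N^{-1}h^{-P\cdot T}\to0$ as $N\to\infty$. Then the asymptotic mean integrated squared error of $\hat f(\cdot;h)$ is $$\mathrm{AMISE}(\hat f(\cdot;h))=N^{-1}h^{-(P\cdot T)}R(K)+\tfrac14h^4m_2(K)^2R(\Delta f),$$ that is, $\mathrm{MISE}(\hat f(\cdot;h))=\mathrm{AMISE}(\hat f(\cdot;h))+o\big(N^{-1}h^{-(P\cdot T)}\big)+o(h^4)$ as $N\to\infty$.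 Moreover, for each $N$, the AMISE as a function of $h>0$ is minimized by $$h_{\mathrm{AMISE}}=\left(\frac{(P\cdot T)\,R(K)}{m_2(K)^2R(\Delta f)}\right)^{\frac{1}{(P\cdot T)+4}}N^{-\frac{1}{(P\cdot T)+4}}.$$
   Context: $\mathbb{R}^{P,T}$ is the vector space of real $P\times T$ matrices $X=\{x_{p,t}\}$. Integrals over $\mathbb{R}^{P,T}$ and derivatives are taken component-wise, i.e. $\mathbb{R}^{P,T}$ is identified with $\mathbb{R}^{P\cdot T}$ with Lebesgue measure. $\mathrm{vec}(X)\in\mathbb{R}^{P\cdot T}$ stacks the columns of $X$, and $\mathbb{I}_{P\cdot T}$ is the identity matrix of size $P\cdot T$. The mean integrated squared error is $\mathrm{MISE}(\hat f(\cdot;h))=\mathbb{E}\int_{\mathbb{R}^{P,T}}(\hat f(X;h)-f(X))^2\,dX$. The AMISE is the leading-order asymptotic approximation of the MISE as $N\to\infty$. For $a:\mathbb{R}^{P,T}\to\mathbb{R}$, $\Delta a=\sum_{p=1}^P\sum_{t=1}^T\frac{\partial^2a(X)}{\partial x_{p,t}^2}$ is the Laplacian and, for a square integrable $a$, $R(a)=\int_{\mathbb{R}^{P,T}}a(X)^2\,dX$. *)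

(* Defs.v *)
From HB Require Import structures.
From mathcomp Require Import all_boot all_order all_algebra.
From mathcomp Require Import all_classical all_reals all_analysis.

Set Implicit Arguments.
Unset Strict Implicit.
Unset Printing Implicit Defensive.
Import Order.TTheory GRing.Theory Num.Theory.
Import numFieldNormedType.Exports.

Local Open Scope classical_set_scope.
Local Open Scope ring_scope.

Section lebesgue_tuple.
Context {R : realType}.
Local Notation RT := (measurableTypeR R).

Definition tcons n (x : RT * n.-tuple RT) : n.+1.-tuple RT :=
  [the n.+1.-tuple RT of x.1 :: x.2].

Lemma measurable_tcons n : measurable_fun [set: RT * n.-tuple RT] (@tcons n).
Proof. exact: measurable_cons. Qed.

Definition lebesgue_tcons n
    (mu : {sigma_finite_measure set (n.-tuple RT) -> \bar R}) :=
  pushforward (lebesgue_measure \x mu)%E (@tcons n).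

Section lebesgue_tcons_measure.
Variables (n : nat) (mu : {sigma_finite_measure set (n.-tuple RT) -> \bar R}).

Let tcons0 : lebesgue_tcons mu set0 = 0%E.
Proof. by rewrite /lebesgue_tcons /pushforward preimage_set0 measure0. Qed.

Let tcons_ge0 A : (0 <= lebesgue_tcons mu A)%E.
Proof. by rewrite /lebesgue_tcons /pushforward; exact: measure_ge0. Qed.

Let tcons_sigma_additive : semi_sigma_additive (lebesgue_tcons mu).
Proof.
move=> F mF tF mUF; rewrite /lebesgue_tcons /pushforward preimage_bigcup.
apply: measure_semi_sigma_additive.
- by move=> k; rewrite -[X in measurable X]setTI; exact: measurable_tcons.
- apply/trivIsetP => /= i j _ _ ij; rewrite -preimage_setI.
  by move/trivIsetP : tF => /(_ _ _ _ _ ij) ->//; rewrite preimage_set0.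
- rewrite -preimage_bigcup -[X in measurable X]setTI.
  exact: measurable_tcons.
Qed.

HB.instance Definition _ := isMeasure.Build _ _ _ (lebesgue_tcons mu)
  tcons0 tcons_ge0 tcons_sigma_additive.

Let uncons (t : n.+1.-tuple RT) : RT * n.-tuple RT :=
  (thead t, [tuple of behead t]).

Let measurable_uncons : measurable_fun setT uncons.
Proof.
apply/measurable_fun_pairP; split; first exact: measurable_tnth.
exact: measurable_behead.
Qed.

Let tcons_sigma_finite : sigma_finite setT (lebesgue_tcons mu).
Proof.
have /sigma_finiteP[F [TF ndF Foo]] := sigma_finiteT (@lebesgue_measure R).
have /sigma_finiteP[G [TG ndG Goo]] := sigma_finiteT mu.
exists (fun k => uncons @^-1` (F k `*` G k)).
  rewrite -preimage_bigcup; apply/seteqP; split => // t _ /=.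
  have [i _ Fi] : (\bigcup_i F i) (thead t) by rewrite -TF.
  have [j _ Gj] : (\bigcup_j G j) [tuple of behead t] by rewrite -TG.
  exists (maxn i j) => //=; split.
  - by move: Fi; exact/subsetPset/ndF/leq_maxl.
  - by move: Gj; exact/subsetPset/ndG/leq_maxr.
move=> k; have [mFk Fkoo] := Foo k; have [mGk Gkoo] := Goo k; split.
  rewrite -[X in measurable X]setTI; apply: measurable_uncons => //.
  exact: measurableX.
rewrite /lebesgue_tcons /pushforward -comp_preimage.
have -> : uncons \o @tcons n = id.
  apply/funext => -[x t]; rewrite /uncons /tcons /=; congr pair.
  exact/val_inj.
by rewrite preimage_id product_measure1E// lte_mul_pinfty// ge0_fin_numE.
Qed.

HB.instance Definition _ := Measure_isSigmaFinite.Build _ _ _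
  (lebesgue_tcons mu) tcons_sigma_finite.

End lebesgue_tcons_measure.

(* Lebesgue measure on R^n as the n-fold product of [lebesgue_measure]; see
   [lebesgue_tuple_box]. *)
Fixpoint lebesgue_tuple n :
    {sigma_finite_measure set (n.-tuple RT) -> \bar R} :=
  if n is m.+1 then lebesgue_tcons (lebesgue_tuple m)
  else \d_([tuple] : 0.-tuple RT).

End lebesgue_tuple.

Definition measure_matrix_display : measure_display.
Proof. exact: default_measure_display. Qed.

Section lebesgue_mx.
Context {R : realType} {m n : nat}.
Local Notation RT := (measurableTypeR R).

(* Matrices carry the product sigma-algebra of their entries. They are
   identified with tuples row by row; by [lebesgue_mx_box] the resulting
   measure does not depend on the order of the entries. *)
Definition mxcoord (k : 'I_(m * n)) (X : 'M[R]_(m, n)) : RT := mxvec X 0 k.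

Let mx_set0 : g_sigma_preimage mxcoord set0.
Proof. exact: sigma_algebra0. Qed.

Let mx_setC A : g_sigma_preimage mxcoord A -> g_sigma_preimage mxcoord (~` A).
Proof. exact: sigma_algebraC. Qed.

Let mx_bigcup (F : _^nat) : (forall i, g_sigma_preimage mxcoord (F i)) ->
  g_sigma_preimage mxcoord (\bigcup_i (F i)).
Proof. exact: sigma_algebra_bigcup. Qed.

HB.instance Definition _ := @isMeasurable.Build measure_matrix_display
  'M[R]_(m, n) (g_sigma_preimage mxcoord) mx_set0 mx_setC mx_bigcup.

Definition mx_of_tuple (t : (m * n).-tuple RT) : 'M[R]_(m, n) :=
  vec_mx (\row_k tnth t k).

Definition tuple_of_mx (X : 'M[R]_(m, n)) : (m * n).-tuple RT :=
  [tuple mxcoord k X | k < m * n].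

Lemma mx_of_tupleK : cancel mx_of_tuple tuple_of_mx.
Proof.
move=> t; apply: eq_from_tnth => k.
by rewrite tnth_mktuple /mxcoord /mx_of_tuple vec_mxK mxE.
Qed.

Lemma tuple_of_mxK : cancel tuple_of_mx mx_of_tuple.
Proof.
move=> X; rewrite /mx_of_tuple -[RHS]mxvecK; congr vec_mx.
by apply/rowP => k; rewrite mxE tnth_mktuple.
Qed.

Lemma measurable_mxcoord k : measurable_fun [set: 'M[R]_(m, n)] (mxcoord k).
Proof.
move=> _ Y mY; rewrite setTI; apply: sub_sigma_algebra => /=.
rewrite -bigcup_seq/=; exists k => /=; first by rewrite mem_index_enum.
by exists Y => //; rewrite setTI.
Qed.

Lemma measurable_mx_of_tuple : measurable_fun setT mx_of_tuple.
Proof.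
have coordE k : mxcoord k \o mx_of_tuple = @tnth _ RT ^~ k.
  by apply/funext => t /=; rewrite /mxcoord /mx_of_tuple vec_mxK mxE.
move=> _ A mA; have := g_sigma_preimage_comp mxcoord mx_of_tuple.
under eq_fun do rewrite coordE.
move=> E; suff : g_sigma_preimage (fun k => @tnth _ RT ^~ k)
  ([set: (m * n).-tuple RT] `&` mx_of_tuple @^-1` A) by [].
by rewrite E; exists A.
Qed.

Lemma measurable_tuple_of_mx : measurable_fun setT tuple_of_mx.
Proof.
apply/measurable_fun_tnthP => k.
rewrite (_ : _ \o _ = mxcoord k); first exact: measurable_mxcoord.
by apply/funext => X /=; rewrite tnth_mktuple.
Qed.

Definition lebesgue_mx : set 'M[R]_(m, n) -> \bar R :=
  pushforward (lebesgue_tuple (m * n)) mx_of_tuple.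

Let lebesgue_mx0 : lebesgue_mx set0 = 0%E.
Proof. by rewrite /lebesgue_mx /pushforward preimage_set0 measure0. Qed.

Let lebesgue_mx_ge0 A : (0 <= lebesgue_mx A)%E.
Proof. by rewrite /lebesgue_mx /pushforward; exact: measure_ge0. Qed.

Let lebesgue_mx_sigma_additive : semi_sigma_additive lebesgue_mx.
Proof.
move=> F mF tF mUF; rewrite /lebesgue_mx /pushforward preimage_bigcup.
apply: measure_semi_sigma_additive.
- by move=> k; rewrite -[X in measurable X]setTI; exact: measurable_mx_of_tuple.
- apply/trivIsetP => /= i j _ _ ij; rewrite -preimage_setI.
  by move/trivIsetP : tF => /(_ _ _ _ _ ij) ->//; rewrite preimage_set0.
- rewrite -preimage_bigcup -[X in measurable X]setTI.
  exact: measurable_mx_of_tuple.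
Qed.

HB.instance Definition _ := isMeasure.Build _ _ _ lebesgue_mx
  lebesgue_mx0 lebesgue_mx_ge0 lebesgue_mx_sigma_additive.

Let lebesgue_mx_sigma_finite : sigma_finite setT lebesgue_mx.
Proof.
have [F TF Foo] := sigma_finiteT (@lebesgue_tuple R (m * n)).
exists (fun k => tuple_of_mx @^-1` F k).
  by rewrite -preimage_bigcup -TF preimage_setT.
move=> k; have [mFk Fkoo] := Foo k; split.
  by rewrite -[X in measurable X]setTI; exact: measurable_tuple_of_mx.
rewrite /lebesgue_mx /pushforward -comp_preimage.
rewrite (_ : _ \o _ = id)//.
by apply/funext => t /=; rewrite mx_of_tupleK.
Qed.

HB.instance Definition _ := Measure_isSigmaFinite.Build _ _ _
  lebesgue_mx lebesgue_mx_sigma_finite.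

End lebesgue_mx.

Lemma lebesgue_tuple_box (R : realType) n
    (A : 'I_n -> set (measurableTypeR R)) :
  (forall i, measurable (A i)) ->
  lebesgue_tuple n [set t | forall i, A i (tnth t i)] =
  (\big[*%E/1%E]_(i < n) lebesgue_measure (A i))%E.
Proof.
elim: n A => [|n IH] A mA.
  rewrite big_ord0 /= diracE mem_set//= => i; by case: i.
rewrite big_ord_recl /= /lebesgue_tcons /pushforward.
pose B : set (n.-tuple (measurableTypeR R)) :=
  [set t | forall i, A (lift ord0 i) (tnth t i)].
have -> : (@tcons R n) @^-1` [set t | forall i, A i (tnth t i)] = A ord0 `*` B.
  apply/seteqP; split => [[x t] /= H|[x t] /= [A0 H] i].
    split; first by have := H ord0; rewrite /tcons /= tnth0.
    by move=> i; have := H (lift ord0 i); rewrite /tcons /= tnthS.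
  have [j ->|->] := unliftP ord0 i; first by rewrite /tcons tnthS; exact: H.
  by rewrite /tcons tnth0.
rewrite product_measure1E//.
  by congr (_ * _)%E; exact: IH.
have -> : B = \big[setI/setT]_(i < n) (@tnth _ (measurableTypeR R) ^~ i @^-1` A (lift ord0 i)).
  rewrite -bigcap_seq; apply/seteqP; split => t /= H i.
    by move=> _; exact: H.
  by apply: H; rewrite /= mem_index_enum.
apply: bigsetI_measurable => i _; rewrite -[X in measurable X]setTI.
exact: measurable_tnth.
Qed.

Lemma lebesgue_mx_box (R : realType) m n
    (A : 'I_m -> 'I_n -> set (measurableTypeR R)) :
  (forall i j, measurable (A i j)) ->
  lebesgue_mx [set X : 'M[R]_(m, n) | forall i j, A i j (X i j)] =
  (\big[*%E/1%E]_i \big[*%E/1%E]_j lebesgue_measure (A i j))%E.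
Proof.
move=> mA; rewrite pair_bigA /= /lebesgue_mx /pushforward.
have [g gK Kg] := curry_mxvec_bij m n.
have {}gK p : g (mxvec_index p.1 p.2) = p by case: p => i j; have := gK (i, j); apply; rewrite inE.
have {}Kg k : mxvec_index (g k).1 (g k).2 = k.
  by rewrite -[RHS]Kg//; case: (g k).
transitivity (\big[*%E/1%E]_k lebesgue_measure (A (g k).1 (g k).2))%E;
  last first.
  rewrite (reindex (uncurry (@mxvec_index m n))) /=; last first.
    exact: curry_mxvec_bij.
  by apply: eq_bigr => -[i j] _; rewrite /= (gK (i, j)).
rewrite -(@lebesgue_tuple_box R _ (fun k => A (g k).1 (g k).2))//.
apply: congr1; apply/seteqP; split => t /= H.
  move=> k; have := H (g k).1 (g k).2.
  rewrite /mx_of_tuple mxE mxE.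
  by rewrite Kg.
move=> i j; rewrite /mx_of_tuple mxE mxE.
by have := H (mxvec_index i j); rewrite (gK (i, j)).
Qed.

Section statistics.
Context d (Omega : measurableType d) (R : realType) (Pr : probability Omega R).

Definition mutually_independent d' (T' : measurableType d')
    (X : nat -> {RV Pr >-> T'}) :=
  forall (J : seq nat) (A : nat -> set T'), uniq J ->
    (forall n, measurable (A n)) ->
    Pr (\bigcap_(n in [set` J]) X n @^-1` A n) =
    (\big[*%E/1%E]_(n <- J) Pr (X n @^-1` A n))%E.

(* A common density also makes the variables identically distributed. *)
Definition has_density d' (T' : measurableType d')
    (mu : {measure set T' -> \bar R}) (Y : {RV Pr >-> T'}) (f : T' -> R) :=
  [/\ measurable_fun setT f, forall x, 0 <= f x &
      forall A, measurable A ->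
        distribution Pr Y A = (\int[mu]_(x in A) (f x)%:E)%E].

End statistics.

Section kde.
Context {R : realType} {P T : nat}.
Local Notation MX := 'M[R]_(P, T).
Local Notation mu := (@lebesgue_mx R P T).

Definition square_integrable (a : MX -> R) := a \in Lfun mu 2%:E.

Definition roughness (a : MX -> R) : R := \int[mu]_X (a X ^+ 2).

Definition partial (p : 'I_P) (t : 'I_T) (a : MX -> R) : MX -> R :=
  fun X => 'D_(delta_mx p t) a X.

Definition laplacian (a : MX -> R) : MX -> R :=
  fun X => \sum_p \sum_t partial p t (partial p t a) X.

(* The second clause says that the differential of [a], identified with the
   gradient, is itself differentiable. *)
Definition twice_differentiable (a : MX -> R) :=
  (forall X, differentiable a X) /\
  (forall p t X, differentiable (partial p t a) X).

(* [mxvec] stacks rows and yields a row vector, hence the two transpositions. *)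
Definition vec (X : MX) : 'cV[R]_(T * P) := (mxvec X^T)^T.

Definition is_kernel (K : MX -> R) :=
  [/\ forall X, 0 <= K X,
      mu.-integrable setT (EFin \o K) &
      \int[mu]_X K X = 1].

(* Entrywise form of the matrix equation [\int X K(X) dX = 0]. *)
Definition centered (K : MX -> R) := forall p t,
  mu.-integrable setT (fun X => (X p t * K X)%:E) /\ \int[mu]_X (X p t * K X) = 0.

Definition isotropic_second_moment (K : MX -> R) (m2 : R) :=
  [/\ forall i j, mu.-integrable setT
        (fun X => ((vec X *m (vec X)^T) i j * K X)%:E),
      \matrix_(i, j) (\int[mu]_X ((vec X *m (vec X)^T) i j * K X)) = m2%:M &
      forall p t, m2 = \int[mu]_X (X p t ^+ 2 * K X)].

Section estimator.
Context d (Omega : measurableType d) (Pr : probability Omega R).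
Variables (K : MX -> R) (X : nat -> {RV Pr >-> MX}) (N : nat) (h : R).

(* The sample X_1, ..., X_N is [X 0, ..., X N.-1]. *)
Definition kde (omega : Omega) (x : MX) : R :=
  (N%:R * h ^+ (P * T))^-1 * \sum_(n < N) K (h^-1 *: (x - X n omega)).

Definition MISE (f : MX -> R) : \bar R :=
  (\int[Pr]_omega \int[mu]_x ((kde omega x - f x) ^+ 2)%:E)%E.

End estimator.

Definition AMISE (K f : MX -> R) (m2 : R) (N : nat) (h : R) : R :=
  N%:R^-1 * h ^- (P * T) * roughness K
  + 4^-1 * h ^+ 4 * m2 ^+ 2 * roughness (laplacian f).

Definition h_AMISE (K f : MX -> R) (m2 : R) (N : nat) : R :=
  (((P * T)%:R * roughness K) / (m2 ^+ 2 * roughness (laplacian f)))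
    `^ (((P * T)%:R + 4)^-1)
  * N%:R `^ (- ((P * T)%:R + 4)^-1).

End kde.

(* Main.v *)
Require Import Defs.
From HB Require Import structures.
From mathcomp Require Import all_boot all_order all_algebra.
From mathcomp Require Import all_classical all_reals all_analysis.
From mathcomp Require Import measurable_realfun.
From mathcomp Require Import ring lra.
Import Order.TTheory GRing.Theory Num.Theory.
Import numFieldNormedType.Exports.
Set Implicit Arguments.
Unset Strict Implicit.
Unset Printing Implicit Defensive.
Local Open Scope classical_set_scope.
Local Open Scope ring_scope.

(** The bias-variance decomposition gives, with [s = smooth f h K] the mean of
    the estimator,
      [MISE = R(K) / (N h^(PT)) - (1 / N) \int s^2 + \int (s - f)^2].
    The middle term is at most [R(f) / N] by Jensen's inequality, hence
    negligible. Since [K] is centered, Taylor's formula with integral remainder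
    writes [(s - f)(x)] as [h^2] times the integral of [f''(x - t h Z)(Z, Z)]
    against [K(Z) (1 - t) dZ dt], [t] in [[0, 1]]. The second moments of [K] turn
    its value at [h = 0] into [m2 / 2 * laplacian f x], and the difference tends
    to 0 in L^2 by continuity of [f''] and Fatou's lemma.

    For the minimization, [R(laplacian f)] must be nonzero: a density with bounded
    second derivatives tends to 0 at infinity, so by the maximum principle a
    harmonic one would vanish identically. *)

(** * Lebesgue measure on matrices *)

(** [K] has finite second moments only, and [f''] is known to be bounded, continuous and square
    integrable. This gives neither a fourth moment of [K] nor an L^2 function dominating the small
    translates of [f''], so dominated convergence does not apply to the bias remainder. Instead the
    translates converge pointwise and keep the same weighted L^2 norm, which forces convergence in
    norm. The weight depends on [(Z, t)] alone, so translating in [x] leaves it unchanged.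

    For [s] to be a genuine integral at every point, [f] is shown to be bounded. This comes from the
    bound on [f'']: averaged over opposite points, [f] stays large on a cube of fixed size around a
    point where it is large, and the total mass 1 limits its height. The same estimate on a small
    cube gives the decay at infinity.

    All of [R(K)], [m2] and [R(laplacian f)] must be positive: since division by zero returns zero,
    the vanishing of any of them would turn [h_AMISE] into [0]. *)

Definition image_measure d1 d2 (T1 : measurableType d1) (T2 : measurableType d2)
    (R : realType) (m : {measure set T1 -> \bar R}) (f : T1 -> T2)
    (mf : measurable_fun setT f) : {measure set T2 -> \bar R}.
Proof.
by unshelve refine (pushforward m f : {measure set T2 -> \bar R}).
Defined.

Lemma ge0_integral_image_measure d1 d2 (T1 : measurableType d1)
    (T2 : measurableType d2) (R : realType) (m : {measure set T1 -> \bar R})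
    (f : T1 -> T2) (mf : measurable_fun setT f) (g : T2 -> \bar R) :
  measurable_fun setT g -> (forall y, (0 <= g y)%E) ->
  (\int[image_measure m mf]_y g y = \int[m]_x g (f x))%E.
Proof.
by move=> mg g0; rewrite [LHS](@ge0_integral_pushforward _ _ _ _ _ _ mf).
Qed.

Lemma ler_entry_norm (R : realType) m n (X : 'M[R]_(m, n)) i j :
  `|X i j| <= `|X|.
Proof.
rewrite [leRHS]/Num.norm /= mx_normrE; apply/bigmax_geP; right => /=.
by exists (i, j).
Qed.

Lemma ler_norm_entries (R : realType) m n (X : 'M[R]_(m, n)) r :
  0 <= r -> (forall i j, `|X i j| <= r) -> `|X| <= r.
Proof.
move=> r0 Xr; rewrite [leLHS]/Num.norm /= mx_normrE; apply/bigmax_leP.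
by split=> // -[i j] _ /=; exact: Xr.
Qed.

Section measurability.
Context {R : realType} {m n : nat}.
Local Notation RT := (measurableTypeR R).
Local Notation MX := 'M[R]_(m, n).

Lemma measurable_entry i j : measurable_fun setT (fun X : MX => X i j : RT).
Proof.
rewrite (_ : (fun _ => _) = mxcoord (mxvec_index i j)).
  exact: measurable_mxcoord.
by apply/funext => X; rewrite /mxcoord mxvecE.
Qed.

Lemma measurable_fun_mxP d (Y : measurableType d) (g : Y -> MX) :
  (forall i j, measurable_fun setT (fun y => g y i j : RT)) ->
  measurable_fun setT g.
Proof.
move=> mg; rewrite (_ : g = mx_of_tuple \o (@tuple_of_mx R m n \o g)); last first.
  by apply/funext => y /=; rewrite tuple_of_mxK.
apply: measurableT_comp; first exact: measurable_mx_of_tuple.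
apply/measurable_fun_tnthP => k.
case/mxvec_indexP: k => i j; rewrite (_ : _ \o _ = fun y => g y i j)//.
by apply/funext => y /=; rewrite tnth_mktuple /mxcoord mxvecE.
Qed.

Lemma measurable_mxD d (Y : measurableType d) (g1 g2 : Y -> MX) :
  measurable_fun setT g1 -> measurable_fun setT g2 ->
  measurable_fun setT (fun y => g1 y + g2 y).
Proof.
move=> m1 m2; apply: measurable_fun_mxP => i j.
under eq_fun do rewrite mxE.
by apply: measurable_funD; apply: (measurableT_comp (measurable_entry i j)).
Qed.

Lemma measurable_mxZ d (Y : measurableType d) (k : Y -> R) (g : Y -> MX) :
  measurable_fun setT k -> measurable_fun setT g ->
  measurable_fun setT (fun y => k y *: g y).
Proof.
move=> mk mg; apply: measurable_fun_mxP => i j.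
under eq_fun do rewrite mxE.
by apply: measurable_funM => //; apply: (measurableT_comp (measurable_entry i j)).
Qed.

Lemma measurable_mxN d (Y : measurableType d) (g : Y -> MX) :
  measurable_fun setT g -> measurable_fun setT (fun y => - g y).
Proof.
move=> mg; under eq_fun do rewrite -scaleN1r.
exact: measurable_mxZ.
Qed.

Lemma measurable_mxB d (Y : measurableType d) (g1 g2 : Y -> MX) :
  measurable_fun setT g1 -> measurable_fun setT g2 ->
  measurable_fun setT (fun y => g1 y - g2 y).
Proof. by move=> m1 m2; apply: measurable_mxD => //; exact: measurable_mxN. Qed.

Definition mxbox (A : 'I_m -> 'I_n -> set RT) : set MX :=
  [set X | forall i j, A i j (X i j)].

Lemma measurable_mxbox (A : 'I_m -> 'I_n -> set RT) :
  (forall i j, measurable (A i j)) -> measurable (mxbox A).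
Proof.
move=> mA.
rewrite (_ : mxbox A = \big[setI/setT]_(p : 'I_m * 'I_n)
    ((fun X : MX => X p.1 p.2 : RT) @^-1` A p.1 p.2)).
  apply: bigsetI_measurable => -[i j] _ /=; rewrite -[X in measurable X]setTI.
  exact: measurable_entry.
rewrite -bigcap_seq; apply/seteqP; split => X /= H.
  by move=> [i j] _; exact: H.
by move=> i j; apply: (H (i, j)); rewrite /= mem_index_enum.
Qed.

Lemma mx_measurable_boxes :
  @measurable _ MX = <<s [set mxbox A | A in [set A | forall i j, measurable (A i j)]] >>.
Proof.
apply/seteqP; split; last first.
  apply: smallest_sub; first exact: sigma_algebra_measurable.
  by move=> _ [A mA <-]; exact: measurable_mxbox.
apply: smallest_sub; first exact: smallest_sigma_algebra.
move=> A; rewrite -bigcup_seq => -[k /= _ [B mB <-]]; rewrite setTI.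
apply: sub_sigma_algebra.
exists (fun i j => if mxvec_index i j == k then B else setT).
  by move=> i j /=; case: ifP.
apply/seteqP; split => X /=.
  case/mxvec_indexP: k => i j H; have := H i j.
  by rewrite eqxx /mxcoord mxvecE.
by move=> BX i j; case: eqP => // ijk; move: BX; rewrite -ijk /mxcoord mxvecE.
Qed.

(** Boxes form a pi-system generating the sigma-algebra, and the cubes with sides [[- k, k]] exhaust
    the space. The second premise serves to make [m1] finite on these cubes. *)
Lemma mx_measure_unique (m1 m2 : {measure set MX -> \bar R}) :
  (forall A, (forall i j, measurable (A i j)) -> m1 (mxbox A) = m2 (mxbox A)) ->
  (forall A, (forall i j, measurable (A i j)) ->
    (forall i j, (lebesgue_measure (A i j) < +oo)%E) -> (m1 (mxbox A) < +oo)%E) ->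
  forall A, measurable A -> m1 A = m2 A.
Proof.
move=> E Eoo; apply: (measure_unique _
   (fun k : nat => mxbox (fun _ _ => `[- k%:R, k%:R]%classic)) mx_measurable_boxes).
- move=> _ _ [A mA <-] [B mB <-]; exists (fun i j => A i j `&` B i j).
    by move=> i j; apply: measurableI.
  apply/seteqP; split => X /= H; first by split => i j; have [] := H i j.
  by move=> i j; split; [exact: H.1|exact: H.2].
- by move=> k; exists (fun _ _ => `[- k%:R, k%:R]%classic) => // i j.
- apply/seteqP; split => // X _; exists (Num.bound `|X|) => // i j /=.
  rewrite in_itv/= -ler_norml (le_trans _ (ltW (archi_boundP _)))//.
  exact: ler_entry_norm.
- by move=> _ [A mA <-]; exact: E.
- move=> k; apply: Eoo => // i j.
  by rewrite lebesgue_measure_itv; case: ifP; rewrite ?ltry.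
Qed.

End measurability.

Lemma lebesgue_measure_affine (R : realType) (a c : R)
    (A : set (measurableTypeR R)) : c != 0 -> measurable A ->
  (`|c|%:E * lebesgue_measure ((fun x => a + c * x)%R @^-1` A) =
   lebesgue_measure A)%E.
Proof.
move=> c0 mA; pose phi (x : measurableTypeR R) : measurableTypeR R := a + c * x.
have mphi : measurable_fun setT phi.
  by apply: measurable_funD => //; exact: measurable_funM.
pose mu' := mscale (NngNum (normr_ge0 c)) (image_measure lebesgue_measure mphi).
have mu'E B : mu' B = (`|c|%:E * lebesgue_measure (phi @^-1` B))%E by [].
rewrite -mu'E; apply/esym.
apply: lebesgue_measure_unique => // _ [[p q]] _ <-.
apply/esym; apply: (eq_trans (mu'E _)) => /=.
have [pq|qp] := ltP p q; last first.
  rewrite set_itv_ge ?bnd_simp -?leNgt// preimage_set0.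
  by rewrite measure0 mule0.
have [cp|cn] := ltP 0 c.
  rewrite (_ : phi @^-1` _ = `](p - a) / c, (q - a) / c]%classic).
    rewrite !lebesgue_measure_itv/= !lte_fin pq ltr_pM2r ?invr_gt0//.
    rewrite ltrD2r pq -!EFinB -EFinM gtr0_norm//; congr EFin.
    by field.
  apply/seteqP; split => x /=; rewrite !in_itv/= ltr_pdivrMr// ler_pdivlMr//;
    by rewrite /phi; move=> /andP[? ?]; apply/andP; split; lra.
(* A negative slope exchanges the endpoints, so the preimage of []p, q]] is closed on the left
   instead of the right. *)
have {}cn : c < 0 by rewrite lt_neqAle c0.
rewrite (_ : phi @^-1` _ = `[(q - a) / c, (p - a) / c[%classic).
  rewrite !lebesgue_measure_itv/= !lte_fin pq ltr_nM2r ?invr_lt0//.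
  rewrite ltrD2r pq -!EFinB -EFinM ltr0_norm//; congr EFin.
  by field.
apply/seteqP; split => x /=; rewrite !in_itv/= ltr_ndivlMr// ler_ndivrMr//;
  by rewrite /phi; move=> /andP[? ?]; apply/andP; split; lra.
Qed.

Section change_of_variables.
Context {R : realType} {m n : nat}.
Local Notation MX := 'M[R]_(m, n).
Local Notation mu := (@lebesgue_mx R m n).
Variables (a : MX) (c : R).
Hypothesis c0 : c != 0.

Let phi (X : MX) : MX := a + c *: X.

Lemma measurable_affine : measurable_fun setT phi.
Proof. by apply: measurable_mxD => //; exact: measurable_mxZ. Qed.

(** The map acts entry by entry, so a box pulls back to a box, and each of the [m * n] sides
    contributes one factor [|c|]. *)
Lemma lebesgue_mx_affine (A : set MX) : measurable A ->
  ((`|c| ^+ (m * n))%:E * mu (phi @^-1` A) = mu A)%E.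
Proof.
move=> mA; have k0 : 0 <= `|c| ^+ (m * n) by rewrite exprn_ge0.
pose mu' := mscale (NngNum k0) (image_measure mu measurable_affine).
have mu'E B : mu' B = ((`|c| ^+ (m * n))%:E * mu (phi @^-1` B))%E by [].
rewrite -mu'E; apply/esym.
apply: mx_measure_unique => // {mA}A mA; last first.
  move=> Aoo; rewrite [X in (X < _)%E](lebesgue_mx_box mA).
  have lty_prod (I : finType) (F : I -> \bar R) :
      (forall i, 0 <= F i < +oo)%E -> (0 <= \big[*%E/1%E]_i F i < +oo)%E.
    move=> Foo; elim/big_ind : _ => [|x y /andP[x0 xoo] /andP[y0 yoo]|//].
      by rewrite lee01 ltry.
    by rewrite mule_ge0//= lte_mul_pinfty// ge0_fin_numE.
  have /(_ _)/andP[|_ //] := lty_prod _ (fun i => \big[*%E/1%E]_j lebesgue_measure (A i j))%E.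
  by move=> i; apply: lty_prod => j; rewrite Aoo measure_ge0.
pose B i j : set (measurableTypeR R) := (fun x => a i j + c * x) @^-1` A i j.
have mB i j : measurable (B i j).
  rewrite -[X in measurable X]setTI.
  suff mh : measurable_fun setT (fun x : measurableTypeR R => a i j + c * x) by exact: (mh measurableT _ (mA i j)).
  by apply: measurable_funD => //; exact: measurable_funM.
apply: (eq_trans _ (esym (mu'E _))); rewrite [LHS](lebesgue_mx_box mA).
have -> : phi @^-1` mxbox A = mxbox B.
  by apply/seteqP; split => X /= H i j; have := H i j; rewrite /phi /B /= !mxE.
rewrite [X in (_ * X)%E](lebesgue_mx_box mB) !pair_bigA /=.
transitivity (\big[*%E/1%E]_(p : 'I_m * 'I_n)
    (`|c|%:E * lebesgue_measure (B p.1 p.2)))%E.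
  by apply: eq_bigr => p _; rewrite lebesgue_measure_affine.
rewrite big_split /=; congr (_ * _)%E.
rewrite big_const card_prod !card_ord.
elim: (m * n)%N => [|k IH] //=.
by rewrite IH exprS EFinM.
Qed.

Lemma ge0_integral_affine (g : MX -> \bar R) : measurable_fun setT g ->
  (forall X, (0 <= g X)%E) ->
  ((`|c| ^+ (m * n))%:E * \int[mu]_X g (a + c *: X)%R = \int[mu]_X g X)%E.
Proof.
move=> mg g0; have k0 : 0 <= `|c| ^+ (m * n) by rewrite exprn_ge0.
rewrite -(ge0_integral_image_measure _ measurable_affine)//.
rewrite -[LHS]/((NngNum k0)%:num%:E * _)%E -ge0_integral_mscale//.
by apply: eq_measure_integral => //= A mA _; rewrite -lebesgue_mx_affine.
Qed.

End change_of_variables.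

Section translation.
Context {R : realType} {m n : nat}.
Local Notation MX := 'M[R]_(m, n).
Local Notation mu := (@lebesgue_mx R m n).

Lemma ge0_integral_translation (a : MX) (g : MX -> \bar R) :
  measurable_fun setT g -> (forall X, (0 <= g X)%E) ->
  (\int[mu]_X g (X - a)%R = \int[mu]_X g X)%E.
Proof.
move=> mg g0; rewrite -[RHS](@ge0_integral_affine _ _ _ (- a) 1)// normr1 expr1n mul1e.
by apply: eq_integral => X _; rewrite scale1r addrC.
Qed.

(** The norm of a matrix is its largest entry in absolute value. For [0 <= r] these boxes are
    therefore its closed balls, and their volume is explicit. *)
Definition mxcube (X : MX) (r : R) : set MX :=
  mxbox (fun i j => `[X i j - r, X i j + r]%classic).

Lemma mxcubeP X r Y : 0 <= r -> mxcube X r Y <-> `|Y - X| <= r.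
Proof.
move=> r0; split=> [XY|YX i j /=].
  apply: ler_norm_entries => // i j; have := XY i j.
  by rewrite !mxE /= in_itv/= ler_distl.
have := le_trans (ler_entry_norm (Y - X) i j) YX.
by rewrite !mxE in_itv/= ler_distl.
Qed.

Lemma measurable_mxcube X r : measurable (mxcube X r).
Proof. by apply: measurable_mxbox => i j; exact: measurable_itv. Qed.

Lemma lebesgue_mx_cube (X : MX) r : 0 <= r ->
  mu (mxcube X r) = ((r + r) ^+ (m * n))%:E.
Proof.
move=> r0.
rewrite [LHS]lebesgue_mx_box; last by move=> i j; exact: measurable_itv.
rewrite pair_bigA /=; transitivity (\big[*%E/1%E]_(p : 'I_m * 'I_n) (r + r)%:E).
  apply: eq_bigr => p _; rewrite lebesgue_measure_itv/= lte_fin.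
  case: ltP => rr; first by rewrite -EFinB; congr EFin; ring.
  by congr EFin; lra.
rewrite big_const card_prod !card_ord.
by elim: (m * n)%N => [|k IH] //=; rewrite IH exprS EFinM.
Qed.

End translation.

(** * Taylor's formula *)

Lemma continuous_sum (R : numFieldType) (S : topologicalType)
    (I : Type) (r : seq I) (F : I -> S -> R) :
  (forall i, continuous (F i)) -> continuous (fun x => \sum_(i <- r) F i x).
Proof.
move=> cF; elim: r => [|i r IH] x.
  rewrite (_ : (fun _ => _) = cst 0); first exact: cvg_cst.
  by apply/funext => y; rewrite big_nil.
rewrite (_ : (fun _ => _) = fun y => F i y + \sum_(j <- r) F j y).
  by apply: cvgD; [exact: cF|exact: IH].
by apply/funext => y; rewrite big_cons.
Qed.

Lemma continuous_cstM (R : numFieldType) (S : topologicalType) (k : R)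
    (g : S -> R) : continuous g -> continuous (fun x => k * g x).
Proof. by move=> cg x; apply: cvgMl_tmp; exact: cg. Qed.

Section taylor.
Context {R : realType} {P T : nat}.
Local Notation MX := 'M[R]_(P, T).
Local Notation leb := (@lebesgue_measure R).

(** The path runs along [- V] to match the argument [x - h *: z] of the convolution. Its difference
    quotient at [s] is literally the directional one of [g] at [X - s *: V]. *)
Lemma is_derive_line (g : MX -> R) (X V : MX) (s : R) :
  (forall Y, differentiable g Y) ->
  is_derive s 1 (fun s : R => g (X - s *: V))
    (- \sum_p \sum_t V p t * partial p t g (X - s *: V)).
Proof.
move=> dg.
have E : (fun t : R => t^-1 *: (((fun s : R => g (X - s *: V)) \o shift s) (t *: 1) - g (X - s *: V)))
    = (fun t : R => t^-1 *: ((g \o shift (X - s *: V)) (t *: (- V)) - g (X - s *: V))).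
  apply/funext => t /=; congr (_ *: (g _ - _)).
  by rewrite [t *: 1]mulr1 scalerDl scalerN opprD addrCA addrA.
have dV : derivable g (X - s *: V) (- V) by exact: diff_derivable.
apply: DeriveDef; first by rewrite /derivable E.
rewrite /derive E -/(derive g (X - s *: V) (- V)) deriveE// linearN; congr (- _).
move: (X - s *: V) {dV E} => Y.
rewrite {1}[V]matrix_sum_delta linear_sum; apply: eq_bigr => p _.
rewrite linear_sum; apply: eq_bigr => t _.
by rewrite linearZ /= /partial deriveE.
Qed.

Variable f : MX -> R.

(** The second differential [f''(X)(V, V)] in coordinates; [grad] is the first differential
    [f'(X)(V)]. *)
Definition hess (X V : MX) : R :=
  \sum_p \sum_t \sum_q \sum_s V p t * V q s * partial q s (partial p t f) X.

Definition grad (X V : MX) : R := \sum_p \sum_t V p t * partial p t f X.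

Hypothesis f2 : twice_differentiable f.
Hypothesis f2c : forall p t q s, continuous (partial q s (partial p t f)).

Lemma continuous_hess V : continuous (hess ^~ V).
Proof.
rewrite /hess; do 4![apply: continuous_sum => ?]; apply: continuous_cstM.
exact: f2c.
Qed.

Lemma is_derive_grad X V (s : R) :
  is_derive s (1 : R) (fun s : R => grad (X - s *: V) V) (- hess (X - s *: V) V).
Proof.
rewrite /grad /hess (_ : - _ = \sum_p \sum_t
  V p t *: (- \sum_q \sum_r V q r * partial q r (partial p t f) (X - s *: V))).
  rewrite (_ : (fun s => _) = \sum_p \sum_t
    (V p t *: (fun s : R => partial p t f (X - s *: V)))); last first.
    apply/funext => r; rewrite fct_sumE; apply: eq_bigr => p _.
    by rewrite fct_sumE.
  apply: is_derive_sum => p; apply: is_derive_sum => t.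
  apply: is_deriveZ; apply: is_derive_line => Y; exact: f2.2.
rewrite -sumrN; apply: eq_bigr => p _; rewrite -sumrN; apply: eq_bigr => t _.
rewrite scalerN; congr (- _); rewrite scaler_sumr; apply: eq_bigr => q _.
rewrite scaler_sumr; apply: eq_bigr => r _.
by rewrite /GRing.scale /= mulrA.
Qed.

Lemma continuous_hess_line X V : continuous (fun s : R => hess (X - s *: V) V).
Proof.
move=> s; apply: (@continuous_comp _ _ _ (fun s : R => X - s *: V) (hess ^~ V)).
  apply: cvgB; first exact: cvg_cst.
  by apply: cvgZr_tmp.
exact: continuous_hess.
Qed.

Lemma continuous_remainder X V :
  continuous (fun s : R => (1 - s) * hess (X - s *: V) V).
Proof.
move=> s; apply: cvgM; last exact: continuous_hess_line.
by apply: cvgB; [exact: cvg_cst|exact: cvg_id].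
Qed.

Lemma taylor X V :
  (\int[leb]_(s in `[0%R, 1%R]) ((1 - s) * hess (X - s *: V) V)%R%:E =
   (f (X - V) - f X + grad X V)%R%:E)%E.
Proof.
(* A primitive of the integrand: the derivative of the factor [1 - s] produces a gradient term that
   cancels the derivative of [f (X - s *: V)]. *)
pose F s := f (X - s *: V) - (1 - s) * grad (X - s *: V) V.
have dF s : is_derive s (1 : R) F ((1 - s) * hess (X - s *: V) V).
  have d1 := @is_derive_line f X V s f2.1.
  have d2 := is_derive_grad X V s.
  rewrite /F; apply: is_derive_eq.
  rewrite /grad; set A := \sum_p _; set B := hess _ _.
  by rewrite /GRing.scale /=; ring.
have cF : continuous F.
  move=> s; apply: differentiable_continuous; apply/derivable1_diffP.
  by have [] := dF s.
rewrite (@continuous_FTC2 _ _ F)//.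
- rewrite /F -EFinB; congr EFin.
  by rewrite scale1r scale0r subr0 subrr; lra.
- by apply: continuous_subspaceT; exact: continuous_remainder.
- split => [s _||].
  + by have [] := dF s.
  + exact/cvg_at_right_filter/cF.
  + exact/cvg_at_left_filter/cF.
- by move=> s _; rewrite derive1E; have [] := dF s.
Qed.

End taylor.

Lemma integral_onem (R : realType) :
  (\int[@lebesgue_measure R]_(s in `[0%R, 1%R]) (1 - s)%R%:E = (2^-1)%:E)%E.
Proof.
pose F (s : R) := s - 2^-1 * s ^+ 2.
have dF (s : R) : is_derive s (1 : R) F (1 - s).
  rewrite /F; apply: is_derive_eq.
  by rewrite /GRing.scale /=; field.
have cF : continuous F.
  move=> s; apply: differentiable_continuous; apply/derivable1_diffP.
  by have [] := dF s.
rewrite (@continuous_FTC2 _ _ F)//.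
- by rewrite /F -EFinB; congr EFin; rewrite expr1n expr0n /=; field.
- apply: continuous_subspaceT => s.
  by apply: cvgB; [exact: cvg_cst|exact: cvg_id].
- split => [s _||].
  + by have [] := dF s.
  + exact/cvg_at_right_filter/cF.
  + exact/cvg_at_left_filter/cF.
- by move=> s _; rewrite derive1E; have [] := dF s.
Qed.

Lemma continuous_gt_ball (R : realType) (V : normedModType R) (g : V -> R) x m :
  continuous g -> m < g x -> exists2 d, 0 < d & forall y, `|x - y| < d -> m < g y.
Proof.
move=> cg mg; have : \forall y \near x, m < g y by apply: cvgr_gt mg; exact: cg.
by move=> /nbhs_normP[d d0 dg]; exists d.
Qed.

Lemma differentiableT_continuous (R : realType) (V W : normedModType R) (g : V -> W) :
  (forall x, differentiable g x) -> continuous g.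
Proof. by move=> dg x; exact: differentiable_continuous. Qed.

Lemma continuous_addr (R : numFieldType) (S : topologicalType) (g1 g2 : S -> R) :
  continuous g1 -> continuous g2 -> continuous (fun x => g1 x + g2 x).
Proof. by move=> c1 c2 x; apply: cvgD; [exact: c1|exact: c2]. Qed.

Lemma continuous_sqr_sub (R : realType) (S : topologicalType) (g : S -> R) (a : R) :
  continuous g -> continuous (fun x => (g x - a) ^+ 2).
Proof.
move=> cg x; have ca : (fun x => g x - a) @ x --> g x - a.
  by apply: cvgB; [exact: cg|exact: cvg_cst].
exact: (cvgM ca ca).
Qed.

Lemma nonexpansive_continuous (R : realType) (V W : normedModType R) (g : V -> W) :
  (forall x y, `|g x - g y| <= `|x - y|) -> continuous g.
Proof.
move=> gg x; apply/cvgrPdist_lt => e e0.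
have : \forall y \near x, `|x - y| < e by apply: cvgr_dist_lt.
by apply: filterS => y; apply: le_lt_trans.
Qed.

Section hessian_bounds.
Context {R : realType} {P T : nat}.
Local Notation MX := 'M[R]_(P, T).
Local Notation leb := (@lebesgue_measure R).
Variable f : MX -> R.
Hypothesis f2 : twice_differentiable f.
Hypothesis f2c : forall p t q s, continuous (partial q s (partial p t f)).

Lemma hess_bound :
  (forall p t q s, [bounded partial q s (partial p t f) x | x in setT]) ->
  exists2 M, 0 < M & forall X V, `|hess f X V| <= M * `|V| ^+ 2.
Proof.
move=> fb.
have /choice[B HB] : forall i : 'I_P * 'I_T * 'I_P * 'I_T, exists B, forall X,
    `|partial i.1.2 i.2 (partial i.1.1.1 i.1.1.2 f) X| <= B.
  move=> [[[p t] q] s]; have [M [_ HM]] := fb p t q s.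
  by exists (M + 1) => X; apply: (HM (M + 1)) => //; rewrite ltrDl.
exists (1 + \sum_p \sum_t \sum_q \sum_s `|B (p, t, q, s)|).
  rewrite ltr_pwDl//; do 4![apply: sumr_ge0 => ? _]; exact: normr_ge0.
move=> X V; apply: (@le_trans _ _
    ((\sum_p \sum_t \sum_q \sum_s `|B (p, t, q, s)|) * `|V| ^+ 2)); last first.
  by rewrite ler_wpM2r ?sqr_ge0// lerDr.
rewrite /hess mulr_suml; apply: le_trans (ler_norm_sum _ _ _) _; apply: ler_sum => p _.
rewrite mulr_suml; apply: le_trans (ler_norm_sum _ _ _) _; apply: ler_sum => t _.
rewrite mulr_suml; apply: le_trans (ler_norm_sum _ _ _) _; apply: ler_sum => q _.
rewrite mulr_suml; apply: le_trans (ler_norm_sum _ _ _) _; apply: ler_sum => s _.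
rewrite normrM mulrC; apply: ler_pM => //.
  by apply: le_trans (ler_norm _); exact: (HB (p, t, q, s)).
by rewrite normrM expr2 ler_pM// ler_entry_norm.
Qed.

Lemma gradN X V : grad f X (- V) = - grad f X V.
Proof.
rewrite /grad -sumrN; apply: eq_bigr => p _; rewrite -sumrN.
by apply: eq_bigr => t _; rewrite mxE mulNr.
Qed.

Lemma integrable_remainder X V :
  leb.-integrable `[0, 1] (fun s : R => ((1 - s) * hess f (X - s *: V) V)%:E).
Proof.
apply: continuous_compact_integrable; first exact: segment_compact.
by apply: continuous_subspaceT; exact: continuous_remainder.
Qed.

Lemma taylor_lower X V m :
  (forall s, 0 <= s <= 1 -> m <= hess f (X - s *: V) V) ->
  m / 2 <= f (X - V) - f X + grad f X V.
Proof.
move=> mh; rewrite -lee_fin -(taylor f2 f2c) EFinM -integral_onem.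
have io : leb.-integrable `[0, 1] (fun s : R => (1 - s)%:E).
  apply: continuous_compact_integrable; first exact: segment_compact.
  apply: continuous_subspaceT => s.
  by apply: cvgB; [exact: cvg_cst|exact: cvg_id].
rewrite -integralZl//; apply: le_integral => //.
- exact: integrableZl.
- exact: integrable_remainder.
- move=> s; rewrite inE/= in_itv/= => s01; rewrite -EFinM lee_fin mulrC.
  by rewrite ler_wpM2l ?mh// subr_ge0; case/andP: s01.
Qed.

Lemma hessN X V : hess f X (- V) = hess f X V.
Proof.
rewrite /hess; apply: eq_bigr => p _; apply: eq_bigr => t _.
apply: eq_bigr => q _; apply: eq_bigr => s _.
by rewrite !mxE mulrNN.
Qed.

Lemma hessZ X V (k : R) : hess f X (k *: V) = k ^+ 2 * hess f X V.
Proof.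
rewrite /hess mulr_sumr; apply: eq_bigr => p _; rewrite mulr_sumr.
apply: eq_bigr => t _; rewrite mulr_sumr; apply: eq_bigr => q _; rewrite mulr_sumr.
apply: eq_bigr => s _; rewrite !mxE; ring.
Qed.

(** Adding Taylor's bounds for [V] and [- V] cancels the gradient. The sum loses only
    [M * |V| ^+ 2]; the weaker form stated here matches the lower bound [f X - M * r ^+ 2] of the
    mass estimates on cubes. *)
Lemma second_difference_lower M X V : (forall X V, `|hess f X V| <= M * `|V| ^+ 2) ->
  2 * (f X - M * `|V| ^+ 2) <= f (X + V) + f (X - V).
Proof.
move=> hM.
have lb W : - (M * `|W| ^+ 2) / 2 <= f (X - W) - f X + grad f X W.
  by apply: taylor_lower => s _; have := hM (X - s *: W) W; rewrite ler_norml => /andP[].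
have M0 : 0 <= M * `|V| ^+ 2 by apply: le_trans (hM X V).
have := lb V; have := lb (- V); rewrite opprK gradN normrN; lra.
Qed.

(** The second-order condition at a maximum, in quantified form. If [hess f Z V] exceeded [- c], it
    would by continuity exceed the midpoint [m] near [Z], and Taylor's formula in both directions
    would bound the second difference below by [m * s ^+ 2]. *)
Lemma hess_le_max Z V (c : R) : (exists2 e, 0 < e & forall s, 0 < s < e ->
    f (Z + s *: V) + f (Z - s *: V) - 2 * f Z <= - (c * s ^+ 2)) ->
  hess f Z V <= - c.
Proof.
move=> [e e0 fe]; rewrite leNgt; apply/negP => ch.
pose m := (hess f Z V - c) / 2.
have mh : m < hess f Z V by rewrite /m; lra.
have cm : - c < m by rewrite /m; lra.
have [d d0 dm] := continuous_gt_ball (@continuous_hess _ _ _ _ f2c V) mh.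
(* This keeps [Z + s *: V] and [Z - s *: V] within [d] of [Z]; the [+ 1] avoids a division by zero
   when [V = 0]. *)
pose s := Num.min (e / 2) (d / 2 / (`|V| + 1)).
have V1 : 0 < `|V| + 1 by rewrite ltr_wpDl.
have s0 : 0 < s by rewrite /s lt_min !divr_gt0.
have se : s < e by rewrite /s gt_min; apply/orP; left; rewrite ltr_pdivrMr//; lra.
have sV : s * `|V| < d.
  apply: (@le_lt_trans _ _ (s * (`|V| + 1))); first by rewrite ler_pM2l// lerDl.
  apply: (@le_lt_trans _ _ (d / 2)); last lra.
  by rewrite -ler_pdivlMr// /s ge_min lexx orbT.
have key W : `|W| = s * `|V| -> hess f ^~ W =1 (fun Y => s ^+ 2 * hess f Y V) ->
    s ^+ 2 * m / 2 <= f (Z - W) - f Z + grad f Z W.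
  move=> WV hW; apply: taylor_lower => r /andP[r0 r1]; rewrite hW /=.
  apply: ler_wpM2l; first exact: sqr_ge0.
  apply/ltW/dm.
  rewrite opprB addrC subrK normrZ ger0_norm// WV.
  by apply: le_lt_trans sV; rewrite ler_piMl// mulr_ge0// ltW.
have := key (s *: V); have := key (- (s *: V)).
rewrite normrN normrZ gtr0_norm// gradN opprK => /(_ erefl) k1 /(_ erefl) k2.
have {}k1 := k1 (fun Y => etrans (hessN _ _) (hessZ _ _ _)).
have {}k2 := k2 (fun Y => hessZ _ _ _).
have := fe s; rewrite s0 se => /(_ isT).
have : - c * s ^+ 2 < m * s ^+ 2 by rewrite ltr_pM2r// exprn_gt0.
move: k1 k2; nra.
Qed.

End hessian_bounds.

(** * Maximum principle *)

Section maximum_principle.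
Context {R : realType} {P T : nat}.
Local Notation MX := 'M[R]_(P, T).

Lemma continuous_vec_mx : continuous (vec_mx : 'rV[R]_(P * T) -> MX).
Proof.
apply: nonexpansive_continuous => v w; rewrite -linearB.
by apply: ler_norm_entries => // i j; rewrite mxE; exact: ler_entry_norm.
Qed.

Lemma EVT_mxcube (g : MX -> R) X r : 0 <= r -> continuous g ->
  exists2 Z, mxcube X r Z & forall Y, mxcube X r Y -> g Y <= g Z.
Proof.
move=> r0 cg.
(* Compactness of a product of segments is a statement on row vectors, so the maximum is sought on
   the flattened cube. *)
pose A : set 'rV[R]_(P * T) :=
  [set v | forall k, `[mxvec X 0 k - r, mxvec X 0 k + r]%classic (v 0 k)].
have cA : compact A.
  apply: (@rV_compact R _ (fun k => `[mxvec X 0 k - r, mxvec X 0 k + r]%classic)).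
  by move=> k; exact: segment_compact.
have AP v : A v <-> mxcube X r (vec_mx v).
  split=> H; first by move=> i j /=; have := H (mxvec_index i j); rewrite /= mxvecE mxE.
  by move=> k; case/mxvec_indexP: k => i j; have := H i j; rewrite /= mxvecE mxE.
have A0 : A !=set0.
  exists (mxvec X); apply/AP; rewrite mxvecK; apply/mxcubeP => //.
  by rewrite subrr normr0.
have cgA : {within A, continuous (g \o vec_mx)}.
  apply: continuous_subspaceT => v; apply: continuous_comp.
    exact: continuous_vec_mx.
  exact: cg.
have [c cA' cmax] := compact_EVT_max A0 cA cgA.
exists (vec_mx c); first by apply/AP; rewrite inE in cA'.
move=> Y XY; rewrite -[Y]mxvecK; apply: cmax; rewrite inE; apply/AP.
by rewrite mxvecK.
Qed.

Lemma continuous_entry i j : continuous (fun X : MX => X i j : R).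
Proof.
apply: nonexpansive_continuous => X Y.
by have := ler_entry_norm (X - Y) i j; rewrite !mxE.
Qed.

Lemma sum_delta_mx (g : 'I_P -> 'I_T -> R) p t :
  \sum_i \sum_j (delta_mx p t : MX) i j * g i j = g p t.
Proof.
rewrite (bigD1 p) // (bigD1 t) // !mxE !eqxx mul1r.
rewrite big1 => [|j /negPf nj]; last by rewrite mxE nj andbF mul0r.
rewrite big1 => [|i /negPf ni]; first by rewrite /= !addr0.
by apply: big1 => j _; rewrite mxE ni mul0r.
Qed.

Variable f : MX -> R.
Hypothesis f2 : twice_differentiable f.
Hypothesis f2c : forall p t q s, continuous (partial q s (partial p t f)).

Lemma hess_delta X p t :
  hess f X (delta_mx p t) = partial p t (partial p t f) X.
Proof.
transitivity (\sum_p' \sum_t' (delta_mx p t : MX) p' t' * (\sum_q \sum_s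
    (delta_mx p t : MX) q s * partial q s (partial p' t' f) X)).
  apply: eq_bigr => p' _; apply: eq_bigr => t' _; rewrite mulr_sumr.
  apply: eq_bigr => q _; rewrite mulr_sumr; apply: eq_bigr => s _.
  by rewrite mulrA.
rewrite (sum_delta_mx (fun p' t' => _)).
by rewrite (sum_delta_mx (fun q s => _)).
Qed.

(* Maximum principle: if f(X0) > 0, then f + d |X - X0|^2 with a small d > 0 has
   an interior maximum on a large cube, where its Laplacian would be <= 0. *)
Lemma harmonic_vanishing_at_infinity_le0 : (0 < P)%N -> (0 < T)%N ->
  (forall e, 0 < e -> exists L, forall X, L < `|X| -> f X < e) ->
  (forall X, laplacian f X = 0) -> forall X, f X <= 0.
Proof.
move=> P0 T0 decay harm X0; rewrite leNgt; apply/negP => fX0.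
pose e := f X0 / 2.
have e0 : 0 < e by rewrite divr_gt0.
have [L HL] := decay _ e0.
(* Every point at distance [r] from [X0] has norm greater than [L], so [f] is below [e] there. *)
pose r := `|L| + `|X0| + 1.
have r0 : 0 < r by rewrite ltr_wpDl// addr_ge0.
have PT0 : 0 < (P * T)%:R :> R by rewrite ltr0n muln_gt0 P0.
(* With this [d], [d * q] is at most [e / 2] on the cube. A maximum on the boundary would have
   [g Z < e + e / 2], which is below [f X0 = 2 * e]. *)
pose d := e / (2 * (P * T)%:R * r ^+ 2).
have d0 : 0 < d by rewrite divr_gt0// !mulr_gt0.
pose q (Y : MX) := \sum_i \sum_j (Y i j - X0 i j) ^+ 2.
pose g Y := f Y + d * q Y.
have cg : continuous g.
  apply: continuous_addr; first by apply: differentiableT_continuous; exact: f2.1.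
  apply: continuous_cstM; do 2![apply: continuous_sum => ?].
  by apply: continuous_sqr_sub; exact: continuous_entry.
have [Z XZ Zmax] := EVT_mxcube X0 (ltW r0) cg.
have qX0 : q X0 = 0.
  by rewrite /q big1// => i _; rewrite big1// => j _; rewrite subrr expr0n.
have gX0 : f X0 <= g Z.
  have := Zmax X0; rewrite {1}/g qX0 mulr0 addr0; apply.
  by apply/mxcubeP; [exact: ltW|rewrite subrr normr0 ltW].
have ZX : `|Z - X0| < r.
  rewrite lt_neqAle; apply/andP; split; last exact/(mxcubeP _ _ (ltW r0)).
  apply/eqP => Zr.
  have fZ : f Z < e.
    apply: HL; have := ler_normB Z X0; rewrite Zr /r.
    by have := ler_norm L; lra.
  have qZ : q Z <= (P * T)%:R * r ^+ 2.
    have -> : (P * T)%:R * r ^+ 2 = \sum_(i < P) \sum_(j < T) r ^+ 2.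
      rewrite !sumr_const !card_ord -mulrnA mulr_natl mulnC; congr (_ *+ _).
    apply: ler_sum => i _; apply: ler_sum => j _.
    rewrite -real_normK ?num_real// lerXn2r ?nnegrE ?(ltW r0)// -Zr.
    by have := ler_entry_norm (Z - X0) i j; rewrite !mxE.
  have : d * q Z <= e / 2.
    apply: le_trans (_ : d * ((P * T)%:R * r ^+ 2) <= _); first by rewrite ler_pM2l.
    rewrite /d le_eqVlt; apply/orP; left; apply/eqP; field.
    by rewrite !gt_eqF// ltr0n.
  by move: gX0; rewrite /g; move: fZ; rewrite /e; lra.
(* Steps [s] and [- s] along a coordinate change [q] by [2 * s ^+ 2] in total, while [g] does not
   exceed [g Z]. The second difference of [f] is thus at most [- (2 * d * s ^+ 2)]. *)
have hZ p t : partial p t (partial p t f) Z <= - (2 * d).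
  rewrite -hess_delta; apply: hess_le_max => //.
  exists (r - `|Z - X0|); first by rewrite subr_gt0.
  move=> s /andP[s0 sr].
  have qs (k : R) : q (Z + k *: delta_mx p t) =
      q Z + 2 * k * (Z p t - X0 p t) + k ^+ 2.
    rewrite /q [in LHS](bigD1 p)//= [in RHS](bigD1 p)//=.
    rewrite [in LHS](bigD1 t)//= [X in X + _ + _ + _](bigD1 t)//=.
    rewrite !mxE !eqxx /=.
    rewrite [X in _ + X + _ = _](_ : _ = \sum_(j < T | j != t) (Z p j - X0 p j) ^+ 2); last first.
      by apply: eq_bigr => j /negPf nj; rewrite !mxE eqxx nj mulr0 addr0.
    rewrite [X in _ + X = _](_ : _ = \sum_(i < P | i != p) \sum_j (Z i j - X0 i j) ^+ 2); last first.
      apply: eq_bigr => i /negPf ni; apply: eq_bigr => j _.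
      by rewrite !mxE ni mulr0 addr0.
    ring.
  have inC (k : R) : `|k| = s -> mxcube X0 r (Z + k *: delta_mx p t).
    move=> ks; apply/mxcubeP; first exact: ltW.
    rewrite addrAC (le_trans (ler_normD _ _))// normrZ ks.
    have : `|delta_mx p t : MX| <= 1.
      by apply: ler_norm_entries => // i j; rewrite mxE; case: andP; rewrite ?normr1 ?normr0.
    move: sr; nra.
  have := Zmax _ (inC s (gtr0_norm s0)).
  have := Zmax _ (inC (- s) _); rewrite normrN gtr0_norm// => /(_ erefl).
  rewrite /g !qs scaleNr sqrrN; lra.
have : laplacian f Z <= \sum_(p < P) \sum_(t < T) (- (2 * d)).
  by apply: ler_sum => p _; apply: ler_sum => t _; exact: hZ.
rewrite harm !sumr_const !card_ord -mulrnA mulNrn oppr_ge0 leNgt.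
have -> // : 0 < 2 * d *+ (T * P).
have d20 : 0 < 2 * d by rewrite mulr_gt0.
by rewrite -mulr_natr mulr_gt0// ltr0n muln_gt0 T0.
Qed.

End maximum_principle.

(** * Continuity of translations in weighted L^2 *)

Lemma limn_einf_gt (R : realType) (u : (\bar R)^nat) (a : \bar R) :
  (a < limn_einf u)%E -> \forall n \near \oo, (a < u n)%E.
Proof.
move=> au.
have [n an] : exists n, (a < einfs u n)%E.
  apply: contrapT => H; move: au; rewrite limn_einf_lim ltNge => /negP; apply.
  apply: lime_le; first exact: is_cvg_einfs.
  by near=> n; rewrite leNgt; apply/negP => an; apply: H; exists n.
exists n => // k /= nk; apply: (lt_le_trans an).
by apply: ereal_inf_lbound; exists k.
Unshelve. all: by end_near. Qed.

Lemma cvg_continuous_sub (R : realType) (V : normedModType R) (g : V -> R)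
    (u : nat -> V) x :
  continuous g -> u @ \oo --> 0 -> (fun k => g (x - u k)) @ \oo --> g x.
Proof.
move=> cg u0; have xu : (fun k => x - u k) @ \oo --> x.
  by rewrite -[X in _ --> X]subr0; apply: cvgB; [exact: cvg_cst|exact: u0].
by apply: cvg_comp xu (cg x).
Qed.

Section translation_continuity.
Context {R : realType} {P T : nat}.
Local Notation MX := 'M[R]_(P, T).
Local Notation mu := (@lebesgue_mx R P T).
Context dY (Y : measurableType dY) (nu : {sigma_finite_measure set Y -> \bar R}).
Variables (W : Y -> R) (G : MX * Y -> R) (tau : nat -> Y -> MX).
Hypothesis W0 : forall y, 0 <= W y.
Hypothesis mW : measurable_fun setT W.
Hypothesis mG : measurable_fun setT G.
Hypothesis mtau : forall k, measurable_fun setT (tau k).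
Hypothesis cG : forall y, continuous (fun x => G (x, y)).
Hypothesis tau0 : forall y, tau ^~ y @ \oo --> (0 : MX).

Let Gs k (z : MX * Y) := G (z.1 - tau k z.2, z.2).

Lemma measurable_shift k : measurable_fun setT (fun z : MX * Y => G (z.1 - tau k z.2, z.2)).
Proof.
apply: (measurableT_comp mG); apply/measurable_fun_pairP; split; last first.
  exact: measurable_snd.
apply: measurable_mxB; first exact: measurable_fst.
by apply: (measurableT_comp (mtau k)); exact: measurable_snd.
Qed.

Let mWG (H : MX * Y -> R) : measurable_fun setT H ->
  measurable_fun setT (fun z : MX * Y => (W z.2 * H z ^+ 2)%:E).
Proof.
move=> mH; apply/measurable_EFinP; apply: measurable_funM.
  by apply: (measurableT_comp mW); exact: measurable_snd.
exact: measurable_funX.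
Qed.

Let WG0 (H : MX * Y -> R) z : (0 <= (W z.2 * H z ^+ 2)%:E)%E.
Proof. by rewrite lee_fin mulr_ge0// sqr_ge0. Qed.

(** For fixed [y] the shift is a translation by [tau k y], hence Tonelli in the order that
    integrates over the matrix first. *)
Lemma integral_shift k :
  (\int[mu \x nu]_z (W z.2 * G (z.1 - tau k z.2, z.2) ^+ 2)%R%:E =
   \int[mu \x nu]_z (W z.2 * G z ^+ 2)%R%:E)%E.
Proof.
rewrite (fubini_tonelli2 _ (mWG (measurable_shift k)) (WG0 (Gs k))).
rewrite (fubini_tonelli2 _ (mWG mG) (WG0 G)).
apply: eq_integral => y _; rewrite /fubini_G /=.
exact: (ge0_integral_translation (tau k y)
  (measurableT_comp (mWG mG) (pair2_measurable y)) (fun x => WG0 G (x, y))).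
Qed.

(* Fatou's lemma is applied to [(G_k + G)^2 = 2 G_k^2 + 2 G^2 - (G_k - G)^2], where
   [G_k] is the translate: its integral and that of [(G_k - G)^2] add up to a
   constant. *)
Lemma L2_translation_cvg (e : R) :
  (\int[mu \x nu]_z (W z.2 * G z ^+ 2)%R%:E < +oo)%E -> 0 < e ->
  \forall k \near \oo,
    (\int[mu \x nu]_z (W z.2 * (G (z.1 - tau k z.2, z.2) - G z) ^+ 2)%R%:E < e%:E)%E.
Proof.
set C := (\int[mu \x nu]_z _)%E => Coo e0.
have C0 : (0 <= C)%E by apply: integral_ge0 => z _; exact: WG0.
have Cfin : C \is a fin_num by rewrite ge0_fin_numE.
pose F k z := (W z.2 * (Gs k z + G z) ^+ 2)%:E.
pose D k z := (W z.2 * (Gs k z - G z) ^+ 2)%:E.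
have mGs k : measurable_fun setT (Gs k) := measurable_shift k.
have mF k : measurable_fun setT (F k).
  by apply: mWG; apply: measurable_funD.
have mD k : measurable_fun setT (D k).
  by apply: mWG; apply: measurable_funB.
have F0 k z : (0 <= F k z)%E by exact: (WG0 (Gs k \+ G)).
have D0 k z : (0 <= D k z)%E by exact: (WG0 (Gs k \- G)).
have FD k : (\int[mu \x nu]_z F k z + \int[mu \x nu]_z D k z = 4%:E * C)%E.
  rewrite -ge0_integralD//.
  transitivity (\int[mu \x nu]_z (2%:E * (W z.2 * Gs k z ^+ 2)%:E +
                                  2%:E * (W z.2 * G z ^+ 2)%:E))%E.
    by apply: eq_integral => z _; rewrite /F /D -!EFinM -!EFinD; congr EFin; ring.
  rewrite ge0_integralD//=; [|by move=> z _; rewrite mule_ge0//; exact: WG0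
    |by apply: measurable_funeM; exact: mWG
    |by move=> z _; rewrite mule_ge0//; exact: WG0
    |by apply: measurable_funeM; exact: mWG].
  rewrite !ge0_integralZl//; [|exact: mWG|exact: mWG].
  rewrite integral_shift -/C -ge0_muleDl// -EFinD; congr (_%:E * _)%E; ring.
have Flim : (4%:E * C <= limn_einf (fun k => \int[mu \x nu]_z F k z))%E.
  apply: le_trans (fatou (mu \x nu)%E measurableT mF _) => //.
  rewrite -ge0_integralZl//; last exact: mWG.
  rewrite le_eqVlt; apply/orP; left; apply/eqP/eq_integral => -[x y] _.
  have Gxy : Gs ^~ (x, y) @ \oo --> G (x, y).
    have := @cvg_continuous_sub R MX (fun x => G (x, y)) (tau ^~ y) x (@cG y) (@tau0 y).
    by [].
  have FG : F ^~ (x, y) @ \oo --> (4%:E * (W y * G (x, y) ^+ 2)%:E)%E.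
    rewrite -EFinM; apply: cvg_EFin; first by near=> k.
    rewrite (_ : 4 * _ = W y * ((G (x, y) + G (x, y)) ^+ 2)); last ring.
    have GG : (fun k => Gs k (x, y) + G (x, y)) @ \oo --> G (x, y) + G (x, y).
      by apply: cvgD; [exact: Gxy|exact: cvg_cst].
    apply: cvgMl_tmp; exact: (cvgM GG GG).
  by apply/esym; have [] := cvg_limn_einf_sup FG.
have : (4%:E * C - e%:E < limn_einf (fun k => \int[mu \x nu]_z F k z))%E.
  apply: lt_le_trans Flim; rewrite lteBlDr//.
  by rewrite lteDl// fin_numM.
move=> /limn_einf_gt; apply: filterS => k.
have Foo : (\int[mu \x nu]_z F k z \is a fin_num)%E.
  rewrite ge0_fin_numE; last by apply: integral_ge0.
  apply: (@le_lt_trans _ _ (4%:E * C)%E); last by rewrite lte_mul_pinfty.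
  by rewrite -(FD k) leeDl//; apply: integral_ge0.
rewrite -(FD k) -/(D k _); move: (FD k) => _.
set d := (\int[mu \x nu]_z D k z)%E; rewrite -/d.
rewrite lteBlDr// lteD2lE//.
Unshelve. all: by end_near. Qed.

End translation_continuity.

(* With [h = s * expR l], the bound [1 + x <= expR x] applied to both powers of
   [expR l] leaves a linear term in [l], which vanishes when [s] is critical. *)
Lemma power_tradeoff_min (R : realType) (n : nat) (a b s h : R) :
  0 < a -> 0 < b -> 0 < s -> 0 < h -> 4 * b * s ^+ (n + 4) = n%:R * a ->
  a * s ^- n + b * s ^+ 4 <= a * h ^- n + b * h ^+ 4.
Proof.
move=> a0 b0 s0 h0 crit.
pose l := ln (h / s).
have hE : h = s * expR l.
  by rewrite lnK ?posrE ?divr_gt0// mulrC divfK// gt_eqF.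
have E1 : h ^- n = s ^- n * expR (- (n%:R * l)).
  by rewrite hE exprMn invfM -expRM_natl expRN.
have E2 : h ^+ 4 = s ^+ 4 * expR (4 * l).
  by rewrite hE exprMn -expRM_natl.
have A0 : 0 < a * s ^- n by rewrite mulr_gt0// invr_gt0 exprn_gt0.
have B0 : 0 < b * s ^+ 4 by rewrite mulr_gt0// exprn_gt0.
have cr : 4 * (b * s ^+ 4) = n%:R * (a * s ^- n).
  rewrite [RHS]mulrA -crit exprD; field.
  by rewrite expf_neq0// gt_eqF.
rewrite E1 E2 (mulrA a) (mulrA b); move: A0 B0 cr; set A := a * s ^- n; set B := b * s ^+ 4 => A0 B0 cr.
have l1 : A * (1 + - (n%:R * l)) <= A * expR (- (n%:R * l)).
  by rewrite ler_pM2l// expR_ge1Dx.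
have l2 : B * (1 + 4 * l) <= B * expR (4 * l).
  by rewrite ler_pM2l// expR_ge1Dx.
have lc : 4 * B * l = n%:R * A * l by rewrite cr.
lra.
Qed.

(** * Optimality of the bandwidth *)

Section h_AMISE_optimality.
Context {R : realType} {P T : nat}.
Variables (K f : 'M[R]_(P, T) -> R) (m2 : R) (N : nat).
Hypothesis PT0 : (0 < P * T)%N.
Hypothesis N0 : (0 < N)%N.
Hypothesis RK0 : 0 < roughness K.
Hypothesis m20 : 0 < m2.
Hypothesis RL0 : 0 < roughness (laplacian f).

Let C := ((P * T)%:R * roughness K) / (m2 ^+ 2 * roughness (laplacian f)).
Let C0 : 0 < C.
Proof. by rewrite divr_gt0 ?mulr_gt0 ?exprn_gt0 ?ltr0n. Qed.

Lemma h_AMISE_gt0 : 0 < h_AMISE K f m2 N.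
Proof. by rewrite /h_AMISE mulr_gt0// powR_gt0// ltr0n. Qed.

(** This is the stationarity equation in [h] of [a * h ^- (P * T) + b * h ^+ 4], solved for the
    power of [h]. *)
Lemma h_AMISE_critical : h_AMISE K f m2 N ^+ (P * T + 4) = C / N%:R.
Proof.
have e0 : (P * T)%:R + 4 != 0 :> R by rewrite gt_eqF// ltr_wpDl.
have pw (x r : R) (k : nat) : (x `^ r) ^+ k = x `^ (r * k%:R).
  by rewrite -powR_mulrn ?powR_ge0// powRrM.
rewrite /h_AMISE exprMn !pw natrD.
by rewrite mulNr mulVf// powRr1 ?(ltW C0)// powRN powRr1.
Qed.

Lemma AMISE_h_AMISE_le (h : R) : 0 < h ->
  AMISE K f m2 N (h_AMISE K f m2 N) <= AMISE K f m2 N h.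
Proof.
move=> h0; pose a := N%:R^-1 * roughness K.
pose b := 4^-1 * m2 ^+ 2 * roughness (laplacian f).
have AE t : AMISE K f m2 N t = a * t ^- (P * T) + b * t ^+ 4.
  by rewrite /AMISE /a /b; ring.
have Nr0 : 0 < N%:R :> R by rewrite ltr0n.
rewrite !AE; apply: power_tradeoff_min => //.
- by rewrite mulr_gt0// invr_gt0.
- by rewrite !mulr_gt0// exprn_gt0.
- exact: h_AMISE_gt0.
rewrite h_AMISE_critical /C /a /b; field.
by rewrite !gt_eqF.
Qed.

End h_AMISE_optimality.

(** * Cauchy-Schwarz, densities and independence *)

Lemma integrable_measurable d (S : measurableType d) (R : realType)
    (nu : {measure set S -> \bar R}) (g : S -> R) :
  nu.-integrable setT (EFin \o g) -> measurable_fun setT g.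
Proof. by move=> /(measurable_int nu)/measurable_EFinP. Qed.

Section weighted_cauchy_schwarz.
Context d (S : measurableType d) (R : realType) (nu : {measure set S -> \bar R}).

(** Serves both as Jensen's inequality, with [c = K] and [A = 1], and as the bound on the bias
    remainder. An upper bound [A] on the mass of [c] is enough, and it is positive so that it can be
    divided by. The right-hand side may be infinite. *)
Lemma weighted_cauchy_schwarz (c g : S -> R) (A : R) :
  0 < A -> (forall x, 0 <= c x) -> measurable_fun setT c ->
  measurable_fun setT g -> (\int[nu]_x (c x)%:E <= A%:E)%E ->
  (((\int[nu]_x (c x * g x)) ^+ 2)%:E <=
   A%:E * \int[nu]_x (c x * g x ^+ 2)%:E)%E.
Proof.
move=> A0 c0 mc mg cA.
have [->|] := eqVneq (\int[nu]_x (c x * g x ^+ 2)%:E)%E +oo%E.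
  by rewrite gt0_muley ?leey// lte_fin.
have cg20 x : 0 <= c x * g x ^+ 2 by rewrite mulr_ge0// sqr_ge0.
have mcg2 : measurable_fun setT (fun x => c x * g x ^+ 2).
  by apply: measurable_funM => //; exact: measurable_funX.
have mcg : measurable_fun setT (fun x => c x * g x) by exact: measurable_funM.
rewrite -ltey => cg2oo.
have ic : nu.-integrable setT (EFin \o c).
  apply/integrableP; split; first exact/measurable_EFinP.
  under eq_integral do rewrite gee0_abs ?lee_fin//.
  by rewrite (le_lt_trans cA)// ltry.
have icg2 : nu.-integrable setT (EFin \o (fun x => c x * g x ^+ 2)).
  apply/integrableP; split; first exact/measurable_EFinP.
  by under eq_integral do rewrite gee0_abs ?lee_fin//.
have icg : nu.-integrable setT (EFin \o (fun x => c x * g x)).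
  apply: (le_integrable _ _ _ (integrableD measurableT ic icg2)) => //.
    exact/measurable_EFinP.
  move=> x _ /=; rewrite lee_fin normrM (ger0_norm (c0 x)).
  rewrite (ger0_norm (addr_ge0 (c0 x) (cg20 x))).
  have -> : c x + c x * g x ^+ 2 = c x * (1 + g x ^+ 2) by ring.
  apply: ler_wpM2l => //.
  rewrite -[g x ^+ 2]real_normK ?num_real//.
  have := sqr_ge0 (`|g x| - 1); have := normr_ge0 (g x).
  by rewrite !expr2; nra.
set B := \int[nu]_x (c x * g x); pose a := \int[nu]_x c x.
pose D := \int[nu]_x (c x * g x ^+ 2).
have aA : a <= A.
  by rewrite -lee_fin /a fineK// integrable_fin_num.
have a0 : 0 <= a by exact: Rintegral_ge0.
have D0 : 0 <= D by exact: Rintegral_ge0.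
have key t : 0 <= D - 2 * t * B + t ^+ 2 * a.
  have -> : D - 2 * t * B + t ^+ 2 * a = \int[nu]_x (c x * (g x - t) ^+ 2).
    rewrite /D /B /a -RintegralZl// -RintegralB//; last exact: (integrableZl _ (2 * t) icg).
    rewrite -RintegralZl// -RintegralD//; last exact: (integrableZl _ (t ^+ 2) ic).
      by apply: eq_Rintegral => x _; ring.
    exact: (integrableB _ icg2 (integrableZl _ (2 * t) icg)).
  by apply: Rintegral_ge0 => x _; rewrite mulr_ge0// sqr_ge0.
have -> : (\int[nu]_x (c x * g x ^+ 2)%:E = D%:E)%E.
  by rewrite /D fineK// integrable_fin_num.
rewrite -EFinM lee_fin.
(* [B / A] minimizes the quadratic once its leading coefficient [a] is replaced by the bound [A]. *)
have kA : 0 <= D - 2 * (B / A) * B + (B / A) ^+ 2 * A.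
  apply: le_trans (key (B / A)) _.
  by rewrite lerD2l ler_wpM2l// sqr_ge0.
have E : D - 2 * (B / A) * B + (B / A) ^+ 2 * A = (A * D - B ^+ 2) / A.
  by field; rewrite gt_eqF.
by move: kA; rewrite E pmulr_lge0 ?invr_gt0// subr_ge0.
Qed.

End weighted_cauchy_schwarz.

(** [f] agrees almost everywhere with the Radon-Nikodym derivative of [nu], because both have the
    same integral over every measurable set. The change of variables for that derivative then
    transfers to [f]. *)
Lemma ge0_integral_density d (S : measurableType d) (R : realType)
    (mu : {sigma_finite_measure set S -> \bar R})
    (nu : {finite_measure set S -> \bar R}) (f : S -> R) (phi : S -> \bar R) :
  measurable_fun setT f -> (forall x, 0 <= f x) ->
  (forall A, measurable A -> nu A = \int[mu]_(x in A) (f x)%:E)%E ->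
  measurable_fun setT phi -> (forall x, 0 <= phi x)%E ->
  (\int[nu]_x phi x = \int[mu]_x (phi x * (f x)%:E))%E.
Proof.
move=> mf f0 nuE mphi phi0.
have mfE : measurable_fun setT (EFin \o f) by exact/measurable_EFinP.
have numu : nu `<< mu.
  apply/null_content_dominatesP => A mA A0; rewrite nuE//.
  apply: null_set_integral => //.
  exact: measurable_funTS.
pose g := Radon_Nikodym_SigmaFinite.f nu mu.
have ig : mu.-integrable setT g := Radon_Nikodym_SigmaFinite.f_integrable numu.
have mg : measurable_fun setT g := measurable_int mu ig.
rewrite -(Radon_Nikodym_SigmaFinite.change_of_variables numu)//.
apply: ge0_ae_eq_integral => //.
- by apply: emeasurable_funM.
- by apply: emeasurable_funM.
- move=> x _; rewrite mule_ge0//; exact: Radon_Nikodym_SigmaFinite.f_ge0.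
- by move=> x _; rewrite mule_ge0// lee_fin.
apply: ae_eqe_mul2l; apply: integral_ae_eq => // E _ mE.
by rewrite -(Radon_Nikodym_SigmaFinite.f_integral numu mE) nuE.
Qed.

Section pairwise_independence.
Context d (Omega : measurableType d) (R : realType) (Pr : probability Omega R).
Context d' (S : measurableType d') (X : nat -> {RV Pr >-> S}).
Hypothesis X_indep : mutually_independent X.

Lemma independent_pair i j (A B : set S) : i != j -> measurable A -> measurable B ->
  Pr ((X i @^-1` A) `&` (X j @^-1` B)) = (Pr (X i @^-1` A) * Pr (X j @^-1` B))%E.
Proof.
move=> ij mA mB.
pose C k := if k == i then A else B.
have mC k : measurable (C k) by rewrite /C; case: ifP.
have := @X_indep [:: i; j] C _ mC.
rewrite /= !inE ij big_cons big_seq1 /C eqxx eq_sym (negPf ij) => /(_ isT) <-.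
congr (Pr _); apply/seteqP; split => w /=.
  move=> [Aw Bw] k /=; rewrite !inE => /orP[]/eqP -> /=; first by rewrite eqxx.
  by rewrite eq_sym (negPf ij).
move=> H; split.
  by have := H i; rewrite /= eqxx inE eqxx; exact.
by have := H j; rewrite /= !inE eqxx orbT eq_sym (negPf ij); exact.
Qed.

(** Independence identifies the joint law with the product of the two laws, since they agree on
    rectangles; Tonelli then factors the integral. *)
Lemma expectation_indep_prod i j (phi : S -> R) : i != j ->
  measurable_fun setT phi -> (forall x, 0 <= phi x) ->
  (\int[Pr]_w (phi (X i w) * phi (X j w))%:E =
   (\int[distribution Pr (X i)]_x (phi x)%:E) *
   (\int[distribution Pr (X j)]_x (phi x)%:E))%E.
Proof.
move=> ij mphi phi0.
have mXX : measurable_fun setT (fun w => (X i w, X j w)).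
  by apply/measurable_fun_pairP; split; exact: measurable_funP.
pose joint := image_measure Pr mXX.
have mE : measurable_fun setT (EFin \o phi) by exact/measurable_EFinP.
pose psi (z : S * S) := (phi z.1 * phi z.2)%:E.
have mpsi : measurable_fun setT psi.
  apply/measurable_EFinP; apply: measurable_funM.
    by apply: (measurableT_comp mphi); exact: measurable_fst.
  by apply: (measurableT_comp mphi); exact: measurable_snd.
have psi0 z : (0 <= psi z)%E by rewrite lee_fin mulr_ge0.
transitivity (\int[joint]_z psi z)%E.
  by rewrite /joint ge0_integral_image_measure.
transitivity (\int[distribution Pr (X i) \x distribution Pr (X j)]_z psi z)%E.
  apply: eq_measure_integral => C mC _; apply/esym.
  apply: product_measure_unique => // A B mA mB.
  exact: independent_pair.
rewrite fubini_tonelli1//; set C := (\int[distribution Pr (X j)]_x _)%E.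
have phiE0 x : (0 <= (phi x)%:E)%E by rewrite lee_fin.
have C0 : (0 <= C)%E by apply: integral_ge0.
transitivity (\int[distribution Pr (X i)]_x ((phi x)%:E * C))%E.
  apply: eq_integral => x _; rewrite /fubini_F /psi /=.
  by under eq_integral do rewrite EFinM; rewrite ge0_integralZl.
by rewrite ge0_integralZr.
Qed.

End pairwise_independence.

(** * Mean squared error *)

Section smoothing.
Context {R : realType} {P T : nat}.
Local Notation MX := 'M[R]_(P, T).
Local Notation mu := (@lebesgue_mx R P T).
Variables (f : MX -> R) (B h : R).
Hypothesis mf : measurable_fun setT f.
Hypothesis f0 : forall X, 0 <= f X.
Hypothesis fB : forall X, f X <= B.
Hypothesis h0 : 0 < h.

(** [L] is [K] for the mean of the estimator and [K ^+ 2] for its second moment. *)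
Definition smooth (L : MX -> R) (x : MX) : R :=
  \int[mu]_z (L z * f (x - h *: z)).

Lemma measurable_smooth_arg (g : MX -> R) : measurable_fun setT g ->
  measurable_fun setT (fun xz : MX * MX => g (xz.1 - h *: xz.2)).
Proof.
move=> mg; apply: (measurableT_comp mg); apply: measurable_mxB.
  exact: measurable_fst.
by apply: measurable_mxZ => //; exact: measurable_snd.
Qed.

Section kernel.
Variable L : MX -> R.
Hypothesis L0 : forall x, 0 <= L x.
Hypothesis iL : mu.-integrable setT (EFin \o L).

Let mL : measurable_fun setT L.
Proof. exact: integrable_measurable iL. Qed.

Let mLf : measurable_fun setT (fun xz : MX * MX => (L xz.2 * f (xz.1 - h *: xz.2))%:E).
Proof.
apply/measurable_EFinP; apply: measurable_funM; last exact: measurable_smooth_arg.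
by apply: (measurableT_comp mL); exact: measurable_snd.
Qed.

(** Dominated by [B * L]. The bound on [f] thus ensures that [smooth L x] is a true integral at
    every [x], not a default value. *)
Lemma integrable_smooth x : mu.-integrable setT (fun z => (L z * f (x - h *: z))%:E).
Proof.
apply: (le_integrable _ _ _ (integrableZl measurableT B iL)) => //.
  by have := measurableT_comp mLf (pair1_measurable x).
move=> z _ /=; rewrite lee_fin ger0_norm ?mulr_ge0//.
by rewrite (le_trans _ (ler_norm _))// mulrC ler_wpM2r.
Qed.

Lemma smoothE x : ((smooth L x)%:E = \int[mu]_z (L z * f (x - h *: z))%:E)%E.
Proof. by rewrite /smooth fineK// integrable_fin_num//; exact: integrable_smooth. Qed.

Lemma smooth_ge0 x : 0 <= smooth L x.
Proof. by apply: Rintegral_ge0 => z _; rewrite mulr_ge0. Qed.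

Lemma measurable_smooth : measurable_fun setT (smooth L).
Proof.
apply: (measurableT_comp (f := fine)) => //.
by apply: (measurable_fun_fubini_tonelli_F _ mLf) => xz; rewrite lee_fin mulr_ge0.
Qed.

(** Tonelli and translation invariance. [phi] is the square when bounding the integral of [s ^+ 2],
    and the identity in the variance term. *)
Lemma integral_smooth (phi : R -> R) : measurable_fun setT phi ->
  (forall x, 0 <= phi (f x)) ->
  (\int[mu]_x \int[mu]_z (L z * phi (f (x - h *: z)))%:E =
   (\int[mu]_z (L z)%:E) * \int[mu]_x (phi (f x))%:E)%E.
Proof.
move=> mphi phi0.
have mpf : measurable_fun setT (phi \o f) by exact: measurableT_comp.
have m2 : measurable_fun setT
    (fun xz : MX * MX => (L xz.2 * phi (f (xz.1 - h *: xz.2)))%:E).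
  apply/measurable_EFinP; apply: measurable_funM.
    by apply: (measurableT_comp mL); exact: measurable_snd.
  exact: (@measurable_smooth_arg (phi \o f)).
rewrite (fubini_tonelli (fun xz : MX * MX => (L xz.2 * phi (f (xz.1 - h *: xz.2)))%:E))//; last first.
  by move=> xz; rewrite lee_fin mulr_ge0.
have mpfE : measurable_fun setT (fun x => (phi (f x))%:E) by exact/measurable_EFinP.
transitivity (\int[mu]_z ((L z)%:E * \int[mu]_x (phi (f x))%:E))%E.
  apply: eq_integral => z _ /=.
  rewrite -(@ge0_integral_translation _ _ _ (h *: z) (fun x => (phi (f x))%:E))//.
  rewrite -ge0_integralZl//.
  - by apply: (measurableT_comp mpfE); apply: measurable_mxB.
  - by move=> x _; rewrite lee_fin.
  - by rewrite lee_fin.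
rewrite ge0_integralZr//.
- by apply/measurable_EFinP.
- by move=> x _; rewrite lee_fin.
- by apply: integral_ge0 => x _; rewrite lee_fin.
Qed.

(** The substitution [y = x - h *: z], whose slope [- h] gives the factor [h ^+ (P * T)]. *)
Lemma integral_kernel_density x :
  (\int[mu]_y (L (h^-1 *: (x - y)) * f y)%:E = (h ^+ (P * T) * smooth L x)%:E)%E.
Proof.
have hn : - h != 0 by rewrite oppr_eq0 gt_eqF.
pose g y := (L (h^-1 *: (x - y)) * f y)%:E.
have mg : measurable_fun setT g.
  apply/measurable_EFinP; apply: measurable_funM => //.
  apply: (measurableT_comp mL); apply: measurable_mxZ => //.
  exact: measurable_mxB.
rewrite -(@ge0_integral_affine _ _ _ x (- h) hn g)//; last first.
  by move=> y; rewrite lee_fin mulr_ge0.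
rewrite normrN gtr0_norm// EFinM smoothE; congr (_ * _)%E.
apply: eq_integral => z _; rewrite /g scaleNr opprB addrCA subrr addr0.
by rewrite scalerA mulVf ?scale1r// gt_eqF.
Qed.

End kernel.

End smoothing.

Lemma double_sum_diag (R : comRingType) (N : nat) (a d : R) :
  \sum_(i < N) \sum_(j < N) (if i == j then a else d) =
  N%:R * a + (N%:R ^+ 2 - N%:R) * d.
Proof.
have E (i : 'I_N) : \sum_(j < N) (if i == j then a else d) = N%:R * d + (a - d).
  transitivity (\sum_(j < N) (d + (if j == i then a - d else 0))).
    by apply: eq_bigr => j _; rewrite eq_sym; case: eqP => _; ring.
  rewrite big_split /= sumr_const card_ord -big_mkcond /= big_pred1_eq.
  by rewrite -[d *+ N]mulr_natl.
under eq_bigr do rewrite E.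
by rewrite sumr_const card_ord -[LHS]mulr_natl; ring.
Qed.


(** * Positivity of the AMISE constants *)

Section density_decay.
Context {R : realType} {P T : nat}.
Local Notation MX := 'M[R]_(P, T).
Local Notation mu := (@lebesgue_mx R P T).
Variables (f : MX -> R) (M : R) (nu : {measure set MX -> \bar R}).
Hypothesis f2 : twice_differentiable f.
Hypothesis f2c : forall p t q s, continuous (partial q s (partial p t f)).
Hypothesis M0 : 0 < M.
Hypothesis hM : forall X V, `|hess f X V| <= M * `|V| ^+ 2.
Hypothesis mf : measurable_fun setT f.
Hypothesis f0 : forall X, 0 <= f X.
Hypothesis nuE : forall A, measurable A -> nu A = (\int[mu]_(x in A) (f x)%:E)%E.
Hypothesis nuT : nu setT = 1%E.

(* Averaging f(X + V) + f(X - V) over the cube |V| <= r removes the gradient. *)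
Lemma cube_mass_lower X r : 0 <= r -> M * r ^+ 2 <= f X ->
  (((r + r) ^+ (P * T) * (f X - M * r ^+ 2))%:E <= nu (mxcube X r))%E.
Proof.
move=> r0 rf; rewrite nuE; last exact: measurable_mxcube.
pose g Z := (f Z * \1_(mxcube X r) Z)%:E.
have mg : measurable_fun setT g.
  apply/measurable_EFinP; apply: measurable_funM => //.
  by apply: measurable_indic; exact: measurable_mxcube.
have g0 Z : (0 <= g Z)%E by rewrite lee_fin mulr_ge0// indicE.
have -> : (\int[mu]_(x in mxcube X r) (f x)%:E = \int[mu]_x g x)%E.
  rewrite integral_mkcond; apply: eq_integral => Z _.
  by rewrite /g patchE indicE; case: ifP; rewrite ?mulr1 ?mulr0.
have gE (c : R) : `|c| = 1 -> (\int[mu]_V g (X + c *: V)%R = \int[mu]_V g V)%E.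
  move=> c1; have c0 : c != 0 by rewrite -normr_gt0 c1.
  by rewrite -[RHS](@ge0_integral_affine _ _ _ X c)// c1 expr1n mul1e.
have mgE (c : R) : measurable_fun setT (fun V : MX => g (X + c *: V)).
  exact: (measurableT_comp mg (measurable_affine X c)).
rewrite -(@lee_pmul2l _ 2%:E)//.
have -> : (2%:E * \int[mu]_x g x =
    \int[mu]_V (g (X + (1 : R) *: V)%R + g (X + (- 1 : R) *: V)%R))%E.
  rewrite ge0_integralD//.
  rewrite !gE ?normr1 ?normrN1//.
  by rewrite -[(2%:E)%E]/((1 + 1)%:E)%E EFinD ge0_muleDl// mul1e.
pose c := f X - M * r ^+ 2.
have c0 : 0 <= c by rewrite subr_ge0.
have -> : (2%:E * ((r + r) ^+ (P * T) * c)%:E =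
    \int[mu]_V (2 * c * \1_(mxcube (0 : MX) r) V)%:E)%E.
  under eq_integral do rewrite EFinM.
  rewrite ge0_integralZl//; last by rewrite lee_fin mulr_ge0.
  - rewrite integral_indic; last exact: measurable_mxcube.
    rewrite setIT.
    transitivity ((2 * c)%:E * ((r + r) ^+ (P * T))%:E)%E.
      by rewrite -!EFinM; congr EFin; ring.
    by congr (_ * _)%E; rewrite [RHS]lebesgue_mx_cube.
  - exact: measurableT.
  - by apply/measurable_EFinP/measurable_indic; exact: measurable_mxcube.
apply: ge0_le_integral => //.
- by move=> V _; rewrite lee_fin !mulr_ge0// indicE.
- apply/measurable_EFinP; apply: measurable_funM => //.
  by apply: measurable_indic; exact: measurable_mxcube.
- by apply: emeasurable_funD; exact: mgE.
move=> V _; rewrite /g !indicE.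
have cubeE (a : R) : `|a| = 1 ->
    (X + a *: V \in mxcube X r) = (V \in mxcube (0 : MX) r).
  move=> a1; apply/idP/idP; rewrite !inE => /(mxcubeP _ _ r0) H;
  by apply/(mxcubeP _ _ r0); move: H; rewrite subr0 (addrC X) addrK normrZ a1 mul1r.
rewrite !cubeE ?normrN1 ?normr1//.
have [/set_mem/(mxcubeP _ _ r0) VR|_] := boolP (V \in _); last by rewrite !mulr0 adde0.
rewrite !mulr1 scale1r scaleN1r -EFinD lee_fin.
apply: le_trans (second_difference_lower f2 f2c X V hM).
rewrite ler_pM2l// lerD2l lerN2 ler_pM2l// lerXn2r ?nnegrE//.
by rewrite subr0 in VR.
Qed.

Lemma nu_le1 A : measurable A -> (nu A <= 1)%E.
Proof. by move=> mA; rewrite -nuT le_measure ?inE. Qed.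

(** The cube of radius 1 has volume at least 1 and mass at most 1, so its mean height bounds
    [f X - M] by 1. *)
Lemma density_bounded X : f X <= M + 1.
Proof.
have [fM|/ltW Mf] := leP (f X) M; first by rewrite (le_trans fM)// lerDl.
have := le_trans (@cube_mass_lower X 1 ler01 _) (nu_le1 (measurable_mxcube _ _)).
rewrite expr1n mulr1 => /(_ Mf); rewrite lee_fin => H.
have : 1 <= (1 + 1 : R) ^+ (P * T) by rewrite exprn_ege1// lerDl.
have : 0 <= f X - M by rewrite subr_ge0.
move: H; nra.
Qed.

(** If [f X >= e], the cube of radius [r] around [X] has mass at least [c], a constant independent
    of [X]. It must then meet any centered cube [F k] of mass above [1 - c], which bounds [|X|]. *)
Lemma density_decay e : 0 < e -> exists L, forall X, L < `|X| -> f X < e.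
Proof.
move=> e0.
(* The bound [r <= 1] lets [M * r <= e / 2] control [M * r ^+ 2]. *)
pose r := Num.min 1 (e / 2 / M).
have r0 : 0 < r by rewrite lt_min ltr01 !divr_gt0.
have rM : M * r ^+ 2 <= e / 2.
  have r1 : r <= 1 by rewrite ge_min lexx.
  have re : M * r <= e / 2.
    by rewrite mulrC -ler_pdivlMr// ge_min lexx orbT.
  apply: le_trans re; rewrite ler_pM2l// expr2 ler_piMl// ltW//.
pose c := (r + r) ^+ (P * T) * (e / 2).
have c0 : 0 < c by rewrite mulr_gt0 ?exprn_gt0 ?addr_gt0// divr_gt0.
pose F (k : nat) : set MX := mxcube 0 k%:R.
have FP k Z : F k Z <-> `|Z| <= k%:R by rewrite /F; have := mxcubeP (0 : MX) Z (ler0n R k); rewrite subr0.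
have mF k : measurable (F k) by exact: measurable_mxcube.
have ndF : nondecreasing_seq F.
  move=> i j ij; apply/subsetPset => Z; rewrite !FP => /le_trans; apply.
  by rewrite ler_nat.
have UF : \bigcup_k F k = setT.
  apply/seteqP; split => // Z _; exists (Num.bound `|Z|) => //.
  by apply/FP; rewrite ltW// archi_boundP.
have : nu \o F @ \oo --> 1%E.
  rewrite -nuT -UF; apply: nondecreasing_cvg_mu => //.
  by rewrite UF.
move=> /fine_cvgP[_ /cvgrPdist_lt/(_ _ c0)[k _ /(_ k (leqnn _)) /= Hk]].
exists (k%:R + r) => X XL; rewrite ltNge; apply/negP => eX.
have dis : F k `&` mxcube X r = set0.
  apply/seteqP; split => // Z [/FP Zk /(mxcubeP _ _ (ltW r0)) ZX].
  have := ler_normB Z (Z - X); rewrite subKr => XZ.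
  by move: XL; rewrite ltNge (le_trans XZ)// lerD.
have cX : (c%:E <= nu (mxcube X r))%E.
  apply: le_trans (cube_mass_lower (ltW r0) _); last lra.
  by rewrite lee_fin /c ler_pM2l ?exprn_gt0 ?addr_gt0//; lra.
have : (nu (F k) + nu (mxcube X r) <= 1)%E.
  rewrite -measureU//; last exact: measurable_mxcube.
  by apply: nu_le1; apply: measurableU => //; exact: measurable_mxcube.
have nuF : nu (F k) \is a fin_num.
  by rewrite ge0_fin_numE// (le_lt_trans (nu_le1 (mF k)))// ltry.
have nuF1 : fine (nu (F k)) <= 1 by rewrite -lee_fin fineK// nu_le1.
move=> /(le_trans (leeD2l (nu (F k)) cX)).
rewrite -(fineK nuF) -EFinD lee_fin.
by move: Hk; rewrite ger0_norm ?subr_ge0//; lra.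
Qed.

Lemma laplacian_neq0 : (0 < P)%N -> (0 < T)%N -> exists X, laplacian f X != 0.
Proof.
move=> P0 T0; apply: contrapT => H.
have harm X : laplacian f X = 0.
  by apply/eqP; rewrite -[_ == _]negbK; apply/negP => fX; apply: H; exists X.
have fz := harmonic_vanishing_at_infinity_le0 f2 f2c P0 T0 density_decay harm.
have : nu setT = 0%E.
  rewrite nuE//; apply: integral0_eq => X _; congr EFin.
  by apply/eqP; rewrite eq_le fz f0.
by rewrite nuT => /eqP; rewrite onee_eq0.
Qed.

End density_decay.

Section positivity.
Context {R : realType}.

(** [G] witnesses that [F] is not almost everywhere zero: a zero integral would make [F], hence [G],
    vanish almost everywhere. The witness is [K] for the two kernel constants and the indicator of a
    cube for the Laplacian. *)
Lemma Rintegral_gt0 d (S : measurableType d) (nu : {measure set S -> \bar R})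
    (F G : S -> R) : nu.-integrable setT (EFin \o F) -> measurable_fun setT G ->
  (forall x, 0 <= F x) -> (\int[nu]_x (G x)%:E != 0)%E ->
  {ae nu, forall x, F x = 0 -> G x = 0} -> 0 < \int[nu]_x F x.
Proof.
move=> iF mG F0 G0 FG; rewrite lt_neqAle Rintegral_ge0// andbT eq_sym.
apply: contra_neq G0 => F00.
have mF : measurable_fun setT (EFin \o F) := measurable_int nu iF.
have : (\int[nu]_x `|(EFin \o F) x| = 0)%E.
  under eq_integral do rewrite gee0_abs ?lee_fin//.
  have := integrable_fin_num measurableT iF => /fineK.
  by rewrite -[fine _]/(\int[nu]_x F x) F00 => <-.
move=> /(ae_eq_integral_abs nu measurableT mF) FE.
transitivity (\int[nu]_x cst 0 x)%E; last by rewrite integral0.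
apply: ae_eq_integral => //; first exact/measurable_EFinP.
by apply: filterS2 FE FG => x /= FE FG _; rewrite FG//; have [] := FE I.
Qed.

Context {P T : nat}.
Local Notation MX := 'M[R]_(P, T).
Local Notation mu := (@lebesgue_mx R P T).

Lemma lebesgue_mx_coord_hyperplane p t :
  mu [set X : MX | X p t = 0] = 0%E.
Proof.
pose A i j : set (measurableTypeR R) :=
  if (i == p) && (j == t) then [set 0] else setT.
have mA i j : measurable (A i j) by rewrite /A; case: ifP.
have -> : [set X : MX | X p t = 0] = mxbox A.
  apply/seteqP; split => X /= H.
    by move=> i j; rewrite /A; case: ifP => // /andP[/eqP -> /eqP ->].
  by have := H p t; rewrite /A !eqxx.
rewrite [LHS]lebesgue_mx_box// (bigD1 p)// (bigD1 t)//=.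
(* One side is a singleton of measure zero, and [0 * +oo = 0] absorbs the infinite sides. *)
by rewrite /A !eqxx /= lebesgue_measure_set1 !mul0e.
Qed.

Lemma roughness_gt0 (a : MX -> R) X : measurable_fun setT a ->
  mu.-integrable setT (fun x => (a x ^+ 2)%:E) -> continuous a -> a X != 0 ->
  0 < roughness a.
Proof.
move=> ma ia ca aX.
have c2 := @continuous_sqr_sub R MX a 0 ca.
have a0 : 0 < (a X - 0) ^+ 2 by rewrite subr0 exprn_even_gt0.
have [d d0 ad] := @continuous_gt_ball _ MX _ X 0 c2 a0.
have d20 : 0 <= d / 2 by rewrite divr_ge0// ltW.
apply: (@Rintegral_gt0 _ _ mu _ (\1_(mxcube X (d / 2)))) => //.
- by apply: measurable_indic; exact: measurable_mxcube.
- by move=> x; exact: sqr_ge0.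
- rewrite integral_indic//; last exact: measurable_mxcube.
  rewrite setIT [X in X != _]lebesgue_mx_cube//.
  by rewrite eqe expf_neq0// gt_eqF// addr_gt0// divr_gt0.
- apply: aeW => Y aY; rewrite indicE memNset// => /(mxcubeP _ _ d20).
  rewrite distrC => XY; have /ad : `|X - Y| < d.
    by rewrite (le_lt_trans XY)// ltr_pdivrMr//; lra.
  by rewrite subr0 aY ltxx.
Qed.

End positivity.

(** * Bias-variance decomposition *)

Section mean_squared_error.
Context {R : realType} {P T : nat}.
Local Notation MX := 'M[R]_(P, T).
Local Notation mu := (@lebesgue_mx R P T).
Context d (Omega : measurableType d) (Pr : probability Omega R).
Variables (X : nat -> {RV Pr >-> MX}) (f K : MX -> R) (B h : R) (N : nat).
Hypothesis X_indep : mutually_independent X.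
Hypothesis X_density : forall n, has_density mu (X n) f.
Hypothesis fB : forall x, f x <= B.
Hypothesis h0 : 0 < h.
Hypothesis N0 : (0 < N)%N.
Hypothesis K0 : forall x, 0 <= K x.
Hypothesis iK : mu.-integrable setT (EFin \o K).
Hypothesis iK2 : mu.-integrable setT (fun x => (K x ^+ 2)%:E).

Let mf : measurable_fun setT f. Proof. by case: (X_density 0). Qed.
Let f0 x : 0 <= f x. Proof. by case: (X_density 0). Qed.
Let mK : measurable_fun setT K.
Proof. exact: integrable_measurable iK. Qed.

Let k x n w := K (h^-1 *: (x - X n w)).

Let mk x (L : MX -> R) : measurable_fun setT L ->
  measurable_fun setT (fun y : MX => L (h^-1 *: (x - y))).
Proof.
move=> mL; apply: (measurableT_comp mL); apply: measurable_mxZ => //.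
exact: measurable_mxB.
Qed.

Lemma integral_law (L : MX -> R) n x : (forall x, 0 <= L x) ->
  mu.-integrable setT (EFin \o L) ->
  (\int[distribution Pr (X n)]_y (L (h^-1 *: (x - y)))%:E =
   (h ^+ (P * T) * smooth f h L x)%:E)%E.
Proof.
move=> L0 iL; have [_ _ fE] := X_density n.
have mL : measurable_fun setT L by exact: integrable_measurable iL.
rewrite (ge0_integral_density (mu := mu) mf f0 fE).
- rewrite -(integral_kernel_density mf f0 fB h0 L0 iL).
  by apply: eq_integral => y _; rewrite -EFinM.
- by apply/measurable_EFinP; exact: mk.
- by move=> y; rewrite lee_fin.
Qed.

Lemma expectation_kernel (L : MX -> R) n x : (forall x, 0 <= L x) ->
  mu.-integrable setT (EFin \o L) ->
  (\int[Pr]_w (L (h^-1 *: (x - X n w)))%:E = (h ^+ (P * T) * smooth f h L x)%:E)%E.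
Proof.
move=> L0 iL; rewrite -(integral_law n)//.
have mL : measurable_fun setT L by exact: integrable_measurable iL.
rewrite (@ge0_integral_distribution _ _ _ _ _ Pr (X n) (fun y => (L (h^-1 *: (x - y)))%:E))//.
- by apply/measurable_EFinP; exact: mk.
- by move=> y; rewrite lee_fin.
Qed.

Lemma expectation_kernel_mul i j x :
  (\int[Pr]_w (k x i w * k x j w)%:E =
   (if i == j then h ^+ (P * T) * smooth f h (fun x => K x ^+ 2) x
    else (h ^+ (P * T) * smooth f h K x) ^+ 2)%:E)%E.
Proof.
have [->|ij] := eqVneq i j.
  have := @expectation_kernel (fun x => K x ^+ 2) j x (fun x => sqr_ge0 _) iK2.
  by move=> <-; apply: eq_integral => w _; rewrite expr2.
have := @expectation_indep_prod _ _ _ Pr _ _ X X_indep i j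
  (fun y => K (h^-1 *: (x - y))) ij (mk x mK) (fun y => K0 _).
by rewrite !integral_law// -EFinM -expr2 => <-.
Qed.

Let mkw x n : measurable_fun setT (k x n).
Proof. exact: (measurableT_comp (mk x mK)). Qed.

Let ge0_integrable (F : Omega -> R) (a : R) : measurable_fun setT F ->
  (forall w, 0 <= F w) -> (\int[Pr]_w (F w)%:E = a%:E)%E ->
  Pr.-integrable setT (EFin \o F).
Proof.
move=> mF F0 Fa; apply/integrableP; split; first exact/measurable_EFinP.
under eq_integral do rewrite gee0_abs ?lee_fin//.
by rewrite Fa ltry.
Qed.

Let ik x n : Pr.-integrable setT (EFin \o k x n).
Proof. exact: (ge0_integrable (mkw x n) (fun w => K0 _) (expectation_kernel n x K0 iK)). Qed.

Let ikk x i j : Pr.-integrable setT (EFin \o (fun w => k x i w * k x j w)).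
Proof.
apply: ge0_integrable (expectation_kernel_mul i j x).
- exact: measurable_funM.
- by move=> w; rewrite mulr_ge0 ?K0.
Qed.

(** In the expanded square, the [N] diagonal pairs contribute the second moment of the kernel and
    the [N ^+ 2 - N] others the squared mean. The missing diagonal leaves the term
    [- N%:R^-1 * smooth f h K x ^+ 2]. *)
Lemma mean_squared_error x :
  (\int[Pr]_w ((kde K X N h w x - f x) ^+ 2)%:E =
   (N%:R^-1 * h ^- (P * T) * smooth f h (fun x => K x ^+ 2) x
    - N%:R^-1 * smooth f h K x ^+ 2 + (smooth f h K x - f x) ^+ 2)%:E)%E.
Proof.
set b := smooth f h K x; set v := smooth f h _ x; set n := (P * T)%N.
pose c := (N%:R * h ^+ n)^-1.
transitivity (\int[Pr]_w
  ((\sum_(i < N) \sum_(j < N) (c ^+ 2)%:E * (k x i w * k x j w)%:E) +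
   (\sum_(i < N) (- 2 * c * f x)%:E * (k x i w)%:E) + (f x ^+ 2)%:E))%E.
  apply: eq_integral => w _.
  under eq_bigr do under eq_bigr do rewrite -EFinM.
  under eq_bigr do rewrite sumEFin.
  under [X in (_ + X + _)%E]eq_bigr do rewrite -EFinM.
  rewrite !sumEFin -!EFinD; congr EFin.
  rewrite /kde -/n -/c -mulr_sumr.
  under [X in _ = X + _ + _]eq_bigr do rewrite -mulr_sumr -mulr_sumr.
  rewrite -mulr_sumr -mulr_suml; ring.
have i1 : Pr.-integrable setT (fun w =>
    \sum_(i < N) \sum_(j < N) (c ^+ 2)%:E * (k x i w * k x j w)%:E)%E.
  apply: integrable_sum => // i _; apply: integrable_sum => // j _.
  exact: integrableZl (ikk x i j).
have i2 : Pr.-integrable setT (fun w =>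
    \sum_(i < N) (- 2 * c * f x)%:E * (k x i w)%:E)%E.
  by apply: integrable_sum => // i _; exact: integrableZl (ik x i).
rewrite integralD//; last 2 first.
- exact: integrableD.
- exact: finite_measure_integrable_cst.
rewrite [X in (X + _)%E]integralD// integral_cst//.
rewrite [X in (_ + _ * X)%E](probability_setT Pr) mule1.
rewrite integral_sum//; last first.
  by move=> i; apply: integrable_sum => // j _; exact: integrableZl (ikk x i j).
rewrite integral_sum//; last by move=> i; exact: integrableZl (ik x i).
under [X in (X + _ + _)%E]eq_bigr => i _.
  rewrite integral_sum//; last by move=> j; exact: integrableZl (ikk x i j).
  under eq_bigr => j _.
    rewrite (integralZl measurableT (ikk x i j)) expectation_kernel_mul -EFinM.
    over.
  rewrite sumEFin -mulr_sumr.
  over.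
under [X in (_ + X + _)%E]eq_bigr => i _.
  rewrite (integralZl measurableT (ik x i)) (expectation_kernel _ _ K0 iK) -EFinM.
  over.
rewrite !sumEFin -!EFinD; congr EFin.
rewrite -mulr_sumr.
rewrite (@double_sum_diag _ N (h ^+ n * v) ((h ^+ n * b) ^+ 2)) sumr_const card_ord.
rewrite -[X in _ + X + _ = _]mulr_natl -/b /c.
field.
by rewrite pnatr_eq0 -lt0n N0 expf_neq0// gt_eqF.
Qed.

Hypothesis f2 : mu.-integrable setT (fun x => (f x ^+ 2)%:E).
Hypothesis K1 : \int[mu]_x K x = 1.

Let K1E : (\int[mu]_x (K x)%:E = 1)%E.
Proof. by rewrite -K1 fineK// integrable_fin_num. Qed.

Let mb := measurable_smooth h mf f0 K0 iK.
Let mv := measurable_smooth h mf f0 (fun x => sqr_ge0 (K x)) iK2.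

Lemma smooth_sqr_le :
  (\int[mu]_x (smooth f h K x ^+ 2)%:E <= (roughness f)%:E)%E.
Proof.
have -> : (roughness f)%:E = (\int[mu]_x (f x ^+ 2)%:E)%E.
  by rewrite fineK// integrable_fin_num.
rewrite -[leRHS]mul1e -K1E -(integral_smooth h mf K0 iK (phi := fun y => y ^+ 2)) => [|//|y]; last exact: sqr_ge0.
apply: ge0_le_integral => //.
- by move=> x _; rewrite lee_fin sqr_ge0.
- by apply/measurable_EFinP; exact: measurable_funX.
- apply: (measurable_fun_fubini_tonelli_F
    (fun xz : MX * MX => (K xz.2 * f (xz.1 - h *: xz.2) ^+ 2)%:E)).
    apply/measurable_EFinP; apply: measurable_funM.
      by apply: (measurableT_comp mK); exact: measurable_snd.
    by apply: measurable_funX; exact: measurable_smooth_arg.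
  by move=> xz; rewrite lee_fin mulr_ge0// sqr_ge0.
move=> x _; rewrite -[leRHS]mul1e.
apply: (@weighted_cauchy_schwarz _ _ _ mu K (fun z => f (x - h *: z))) => //.
- exact: (measurableT_comp (measurable_smooth_arg h mf) (pair1_measurable x)).
- by rewrite K1E.
Qed.

Lemma integrable_smooth_sqr : mu.-integrable setT (fun x => (smooth f h K x ^+ 2)%:E).
Proof.
apply/integrableP; split; first by apply/measurable_EFinP; exact: measurable_funX.
under eq_integral do rewrite gee0_abs ?lee_fin ?sqr_ge0//.
by rewrite (le_lt_trans smooth_sqr_le)// ltry.
Qed.

Lemma integrable_bias_sqr :
  mu.-integrable setT (fun x => ((smooth f h K x - f x) ^+ 2)%:E).
Proof.
apply: (le_integrable _ _ _ (integrableD measurableT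
  (integrableZl measurableT 2 integrable_smooth_sqr) (integrableZl measurableT 2 f2))) => //.
  by apply/measurable_EFinP; apply: measurable_funX; exact: measurable_funB.
move=> x _ /=; rewrite lee_fin (ger0_norm (sqr_ge0 _)) ger0_norm; last first.
  by rewrite addr_ge0// mulr_ge0// sqr_ge0.
rewrite -subr_ge0 (_ : _ - _ = (smooth f h K x + f x) ^+ 2) ?sqr_ge0//; ring.
Qed.

Lemma integral_smooth_sqr_kernel :
  (\int[mu]_x (smooth f h (fun x => K x ^+ 2) x)%:E = (roughness K)%:E)%E.
Proof.
under eq_integral do rewrite (smoothE h mf f0 fB (fun x => sqr_ge0 (K x)) iK2).
rewrite (integral_smooth h mf (fun x => sqr_ge0 (K x)) iK2 (phi := id))//.
have [_ _ fE] := X_density 0.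
have -> : (\int[mu]_x (id (f x))%:E = 1)%E.
  by rewrite -(fE setT measurableT) probability_setT.
by rewrite mule1 fineK// integrable_fin_num.
Qed.

Lemma measurable_kde : measurable_fun setT
  (fun wx : Omega * MX => kde K X N h wx.1 wx.2).
Proof.
apply: measurable_funM => //; apply: measurable_sum => i.
apply: (measurableT_comp mK); apply: measurable_mxZ => //.
apply: measurable_mxB; first exact: measurable_snd.
by apply: (measurableT_comp (f := X i)) => //; exact: measurable_fst.
Qed.

Lemma MISE_decomposition : MISE K X N h f =
  (N%:R^-1 * h ^- (P * T) * roughness K
   - N%:R^-1 * (\int[mu]_x (smooth f h K x ^+ 2))
   + \int[mu]_x ((smooth f h K x - f x) ^+ 2))%:E.
Proof.
rewrite /MISE (fubini_tonelli (fun wx : Omega * MX =>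
    ((kde K X N h wx.1 wx.2 - f wx.2) ^+ 2)%:E)); last 2 first.
- apply/measurable_EFinP; apply: measurable_funX; apply: measurable_funB.
    exact: measurable_kde.
  by apply: (measurableT_comp mf); exact: measurable_snd.
- by move=> wx; rewrite lee_fin sqr_ge0.
under eq_integral do rewrite mean_squared_error.
have iv : mu.-integrable setT (EFin \o smooth f h (fun x => K x ^+ 2)).
  apply/integrableP; split; first exact/measurable_EFinP.
  have v0 := smooth_ge0 h f0 (fun x => sqr_ge0 (K x)).
  under eq_integral do rewrite gee0_abs ?lee_fin//.
  by rewrite integral_smooth_sqr_kernel ltry.
set c := N%:R^-1 * h ^- (P * T).
have ic := integrableZl measurableT c iv.
have ib := integrableZl measurableT N%:R^-1 integrable_smooth_sqr.
transitivity (\int[mu]_x ((c%:E * (smooth f h (fun x => K x ^+ 2) x)%:E -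
   (N%:R^-1)%:E * (smooth f h K x ^+ 2)%:E) + ((smooth f h K x - f x) ^+ 2)%:E))%E.
  by apply: eq_integral => x _; rewrite -!EFinM -EFinB -EFinD.
rewrite integralD//; [|exact: integrableB|exact: integrable_bias_sqr].
rewrite integralB// (integralZl measurableT iv) (integralZl measurableT integrable_smooth_sqr).
rewrite integral_smooth_sqr_kernel.
rewrite -[X in (_ - _ * X + _)%E]fineK; last exact: integrable_fin_num integrable_smooth_sqr.
rewrite -[X in (_ + X)%E]fineK; last exact: integrable_fin_num integrable_bias_sqr.
by rewrite -!EFinM -EFinB -EFinD.
Qed.

End mean_squared_error.

(** * Bias *)

Section square_summability.
Context d (S : measurableType d) (R : realType) (nu : {measure set S -> \bar R}).

Definition square_summable (a : S -> R) :=
  measurable_fun setT a /\ nu.-integrable setT (fun x => (a x ^+ 2)%:E).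

Lemma square_summableD a b : square_summable a -> square_summable b ->
  square_summable (fun x => a x + b x).
Proof.
move=> [ma ia] [mb ib]; have mab : measurable_fun setT (fun x => a x + b x).
  exact: measurable_funD.
split=> //; apply: (le_integrable _ _ _ (integrableD measurableT
  (integrableZl measurableT 2 ia) (integrableZl measurableT 2 ib))) => //.
  by apply/measurable_EFinP; apply: measurable_funX.
move=> x _ /=; rewrite lee_fin (ger0_norm (sqr_ge0 _)) ger0_norm; last first.
  by rewrite addr_ge0// mulr_ge0// sqr_ge0.
rewrite -subr_ge0 (_ : _ - _ = (a x - b x) ^+ 2) ?sqr_ge0//; ring.
Qed.

Lemma square_summable_sum (I : Type) (r : seq I) (a : I -> S -> R) :
  (forall i, square_summable (a i)) ->
  square_summable (fun x => \sum_(i <- r) a i x).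
Proof.
move=> ha; elim: r => [|i r IH].
  rewrite (_ : (fun _ => _) = cst 0); last by apply/funext => x; rewrite big_nil.
  split; first exact: measurable_cst.
  under eq_fun do rewrite expr0n/=; exact: integrable0.
rewrite (_ : (fun _ => _) = fun x => a i x + \sum_(j <- r) a j x).
  exact: square_summableD.
by apply/funext => x; rewrite big_cons.
Qed.

Lemma square_summable_normr a : square_summable a ->
  square_summable (fun x => `|a x|).
Proof.
move=> [ma ia]; split; first exact: measurableT_comp.
by under eq_fun do rewrite real_normK ?num_real//.
Qed.

End square_summability.

Lemma integrable_tensor d1 d2 (S1 : measurableType d1) (S2 : measurableType d2)
    (R : realType) (m1 : {sigma_finite_measure set S1 -> \bar R})
    (m2 : {sigma_finite_measure set S2 -> \bar R}) (a : S1 -> R) (b : S2 -> R) :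
  m1.-integrable setT (EFin \o a) -> m2.-integrable setT (EFin \o b) ->
  (m1 \x m2)%E.-integrable setT (EFin \o (fun y => a y.1 * b y.2)).
Proof.
move=> ia ib.
have ma := integrable_measurable ia; have mb := integrable_measurable ib.
apply/integrable12ltyP.
  apply/measurable_EFinP; apply: measurable_funM.
    by apply: (measurableT_comp ma); exact: measurable_fst.
  by apply: (measurableT_comp mb); exact: measurable_snd.
rewrite /=.
have -> : (\int[m1]_x \int[m2]_y `|(a x * b y)%:E| =
    (\int[m1]_x `|(EFin \o a) x|) * \int[m2]_y `|(EFin \o b) y|)%E.
  have ma' : measurable_fun setT (fun x => `|(EFin \o a) x|%E).
    by apply: measurableT_comp => //; exact/measurable_EFinP.
  have mb' : measurable_fun setT (fun x => `|(EFin \o b) x|%E).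
    by apply: measurableT_comp => //; exact/measurable_EFinP.
  rewrite -ge0_integralZr//; last exact: integral_ge0.
  apply: eq_integral => x _; rewrite -ge0_integralZl//.
  by apply: eq_integral => y _; rewrite EFinM abseM.
have [_ oa] := integrableP _ _ _ ia; have [_ ob] := integrableP _ _ _ ib.
by rewrite lte_mul_pinfty ?integral_ge0// ge0_fin_numE// integral_ge0.
Qed.

Lemma Rintegral_lincomb d (S : measurableType d) (R : realType)
    (nu : {measure set S -> \bar R}) (I : Type) (r : seq I) (c : I -> R)
    (g : I -> S -> R) :
  (forall i, nu.-integrable setT (EFin \o g i)) ->
  nu.-integrable setT (EFin \o (fun x => \sum_(i <- r) c i * g i x)) /\
  \int[nu]_x (\sum_(i <- r) c i * g i x) = \sum_(i <- r) c i * \int[nu]_x g i x.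
Proof.
move=> ig; have icg i : nu.-integrable setT (EFin \o (fun x => c i * g i x)).
  exact: (integrableZl measurableT (c i) (ig i)).
elim: r => [|i r [IH1 IH2]].
  rewrite (_ : (fun _ => _) = cst 0); last by apply/funext => x; rewrite big_nil.
  by split; [exact: integrable0|rewrite big_nil Rintegral_cst// mul0r].
rewrite (_ : (fun _ => _) = fun x => c i * g i x + \sum_(j <- r) c j * g j x); last first.
  by apply/funext => x; rewrite big_cons.
split; first exact: (integrableD measurableT (icg i) IH1).
by rewrite RintegralD// IH2 big_cons RintegralZl.
Qed.

Lemma cvg_scale0 (R : realType) (V : normedModType R) (h : nat -> R) (a : R) (v : V) :
  h @ \oo --> 0 -> (fun k => (a * h k) *: v) @ \oo --> 0.
Proof.
move=> h0; rewrite -(scale0r v) -(mulr0 a); apply: cvgZr_tmp.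
exact: cvgMl_tmp.
Qed.

Section mx_time.
Context {R : realType} {P T : nat}.
Local Notation MX := 'M[R]_(P, T).
Local Notation mu := (@lebesgue_mx R P T).
Local Notation leb := (@lebesgue_measure R).
Local Notation RT := (measurableTypeR R).

(* A copy of [mu \x leb]: the library attaches the sigma-finite structure of a
   product only to products of subprobabilities. *)
Definition mx_time : set (MX * RT) -> \bar R := (mu \x leb)%E.

HB.instance Definition _ := Measure.on mx_time.

Let mx_time_sigma_finite : sigma_finite setT mx_time.
Proof.
have /sigma_finiteP[F [TF ndF Foo]] := sigma_finiteT mu.
have /sigma_finiteP[G [TG ndG Goo]] := sigma_finiteT leb.
exists (fun n => F n `*` G n).
  apply/seteqP; split => // -[x y] _.
  have [i _ Fx] : (\bigcup_i F i) x by rewrite -TF.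
  have [j _ Gy] : (\bigcup_j G j) y by rewrite -TG.
  exists (maxn i j) => //=; split.
  - by move: Fx; exact/subsetPset/ndF/leq_maxl.
  - by move: Gy; exact/subsetPset/ndG/leq_maxr.
move=> k; have [mFk Fkoo] := Foo k; have [mGk Gkoo] := Goo k; split.
  exact: measurableX.
by rewrite /mx_time product_measure1E// lte_mul_pinfty// ge0_fin_numE.
Qed.

HB.instance Definition _ := Measure_isSigmaFinite.Build _ _ _
  mx_time mx_time_sigma_finite.

End mx_time.

Section bias.
Context {R : realType} {P T : nat}.
Local Notation MX := 'M[R]_(P, T).
Local Notation mu := (@lebesgue_mx R P T).
Local Notation leb := (@lebesgue_measure R).
Local Notation RT := (measurableTypeR R).

(** The squared Frobenius norm. As a sum of squared entries it is integrable against [K] directly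
    from the second moments, and it dominates the squared max norm. *)
Definition sqn (V : MX) : R := \sum_i \sum_j V i j ^+ 2.

Lemma sqn_ge0 V : 0 <= sqn V.
Proof. by apply: sumr_ge0 => i _; apply: sumr_ge0 => j _; exact: sqr_ge0. Qed.

Lemma sqr_entry_le_sqn (V : MX) i j : V i j ^+ 2 <= sqn V.
Proof.
rewrite /sqn (bigD1 i) //= (bigD1 j) //= -addrA lerDl addr_ge0//.
  by apply: sumr_ge0 => *; exact: sqr_ge0.
by apply: sumr_ge0 => *; apply: sumr_ge0 => *; exact: sqr_ge0.
Qed.

Lemma sqr_norm_le_sqn V : `|V| ^+ 2 <= sqn V.
Proof.
have [V0|V0] := eqVneq (mx_norm V) 0.
  by rewrite [`|V|]V0 expr0n; exact: sqn_ge0.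
have [[i j] /= Vij] := mx_norm_neq0 V0.
by rewrite [`|V|]Vij real_normK ?num_real//; exact: sqr_entry_le_sqn.
Qed.

Lemma normr_entryM_le_sqn (V : MX) p t q s : `|V p t * V q s| <= sqn V.
Proof.
have h1 := sqr_entry_le_sqn V p t; have h2 := sqr_entry_le_sqn V q s.
have := sqr_ge0 (V p t - V q s); have := sqr_ge0 (V p t + V q s).
rewrite ler_norml; move: h1 h2; rewrite !expr2; set a := V p t; set b := V q s.
by move=> *; apply/andP; split; lra.
Qed.

Lemma measurable_sqn : measurable_fun setT sqn.
Proof.
apply: measurable_sum => i; apply: measurable_sum => j.
by apply: measurable_funX; exact: measurable_entry.
Qed.

Lemma hess_pairE (f : MX -> R) X V : hess f X V =
  \sum_(k : ('I_P * 'I_T) * ('I_P * 'I_T)) V k.1.1 k.1.2 * V k.2.1 k.2.2 *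
    partial k.2.1 k.2.2 (partial k.1.1 k.1.2 f) X.
Proof.
rewrite /hess pair_bigA -[RHS](pair_bigA _ (fun i j => V i.1 i.2 * V j.1 j.2 *
  partial j.1 j.2 (partial i.1 i.2 f) X)).
by apply: eq_bigr => i _; rewrite pair_bigA.
Qed.

Lemma grad_pairE (f : MX -> R) X V : grad f X V =
  \sum_(k : 'I_P * 'I_T) V k.1 k.2 * partial k.1 k.2 f X.
Proof. by rewrite /grad pair_bigA. Qed.

Variables (f K : MX -> R) (M B m2 : R).
Hypothesis f2 : twice_differentiable f.
Hypothesis f2c : forall p t q s, continuous (partial q s (partial p t f)).
Hypothesis f2s : forall p t q s, square_summable mu (partial q s (partial p t f)).
Hypothesis M0 : 0 < M.
Hypothesis hM : forall X V, `|hess f X V| <= M * `|V| ^+ 2.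
Hypothesis mf : measurable_fun setT f.
Hypothesis f0 : forall X, 0 <= f X.
Hypothesis fB : forall X, f X <= B.
Hypothesis K0 : forall X, 0 <= K X.
Hypothesis iK : mu.-integrable setT (EFin \o K).
Hypothesis K1 : \int[mu]_X K X = 1.
Hypothesis iK1 : forall p t, mu.-integrable setT (fun X => (X p t * K X)%:E).
Hypothesis KC : forall p t, \int[mu]_X (X p t * K X) = 0.
Hypothesis iK2 : forall p t q s,
  mu.-integrable setT (fun X => (X p t * X q s * K X)%:E).
Hypothesis K2 : forall p t q s, \int[mu]_X (X p t * X q s * K X) =
  if (p == q) && (t == s) then m2 else 0.

Let hessMsqn X V : `|hess f X V| <= M * sqn V.
Proof. by apply: le_trans (hM X V) _; rewrite ler_pM2l// sqr_norm_le_sqn. Qed.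

Let mK : measurable_fun setT K.
Proof. exact: integrable_measurable iK. Qed.

Lemma integrable_sqnK : mu.-integrable setT (fun X => (sqn X * K X)%:E).
Proof.
rewrite (_ : (fun _ => _) = (fun X : MX => \sum_i \sum_j (X i j * X i j * K X)%:E)).
  by apply: integrable_sum => // i _; apply: integrable_sum => // j _.
apply/funext => X; under eq_bigr do rewrite sumEFin; rewrite sumEFin.
congr EFin; rewrite /sqn mulr_suml; apply: eq_bigr => i _.
by rewrite mulr_suml; apply: eq_bigr => j _; rewrite expr2.
Qed.

Lemma measurable_hess d (Y : measurableType d) (u v : Y -> MX) :
  measurable_fun setT u -> measurable_fun setT v ->
  measurable_fun setT (fun y => hess f (u y) (v y)).
Proof.
move=> mu' mv; do 4![apply: measurable_sum => ?].
apply: measurable_funM; last first.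
  by apply: (measurableT_comp (proj1 (f2s _ _ _ _))).
by apply: measurable_funM; apply: (measurableT_comp (measurable_entry _ _)).
Qed.

(* The triangular density 1 - s on [0, 1] of Taylor's integral remainder. *)
Definition tri (s : R) : R := (1 - s) * \1_(`[0, 1]%classic : set RT) s.

Lemma measurable_tri : measurable_fun setT (tri : RT -> R).
Proof.
by apply: measurable_funM; [exact: measurable_funB|exact: measurable_indic].
Qed.

Lemma tri_ge0 s : 0 <= tri s.
Proof.
rewrite /tri indicE; case: (boolP (s \in _)) => [|_]; last by rewrite mulr0.
by rewrite inE/= in_itv/= mulr1 subr_ge0 => /andP[].
Qed.

(** Extending the weight by zero to the whole line turns Taylor's remainder, integrated against [K],
    into a single integral for a product measure. *)
Lemma integral_tri (g : R -> R) :
  (\int[leb]_s (tri s * g s)%:E = \int[leb]_(s in `[0%R, 1%R]) ((1 - s) * g s)%R%:E)%E.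
Proof.
rewrite [RHS]integral_mkcond; apply: eq_integral => s _.
by rewrite patchE /tri indicE; case: ifP => _; rewrite ?mulr1// mulr0 mul0r.
Qed.

Lemma integral_tri1 : (\int[leb]_s (tri s)%:E = (2^-1)%:E)%E.
Proof.
under eq_integral do rewrite -[tri _]mulr1.
rewrite integral_tri -integral_onem.
by apply: eq_integral => s _; rewrite mulr1.
Qed.

Lemma integrable_tri : leb.-integrable setT (EFin \o tri).
Proof.
apply/integrableP; split; first by apply/measurable_EFinP; exact: measurable_tri.
under eq_integral do rewrite gee0_abs ?lee_fin ?tri_ge0//.
by rewrite integral_tri1 ltry.
Qed.

Local Notation nu := (mu \x leb)%E.
Let rem h x (y : MX * RT) : R := hess f (x - (y.2 * h) *: y.1) y.1.

Let mrem h x : measurable_fun setT (rem h x).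
Proof.
apply: measurable_hess; last exact: measurable_fst.
apply: measurable_mxB => //; apply: measurable_mxZ; last exact: measurable_fst.
by apply: measurable_funM => //; exact: measurable_snd.
Qed.

Let mtri2 : measurable_fun setT (fun y : MX * RT => tri y.2).
Proof. by apply: (measurableT_comp measurable_tri); exact: measurable_snd. Qed.

Let mK1 : measurable_fun setT (fun y : MX * RT => K y.1).
Proof. by apply: (measurableT_comp mK); exact: measurable_fst. Qed.

Let msqn1 : measurable_fun setT (fun y : MX * RT => sqn y.1).
Proof. by apply: (measurableT_comp measurable_sqn); exact: measurable_fst. Qed.

Let Ktri_ge0 (y : MX * RT) : 0 <= K y.1 * tri y.2.
Proof. exact: mulr_ge0 (K0 _) (tri_ge0 _). Qed.

Lemma integrable_rem h x :
  nu.-integrable setT (fun y => (K y.1 * tri y.2 * rem h x y)%:E).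
Proof.
apply: (le_integrable _ _ _ (integrableZl measurableT M
  (integrable_tensor integrable_sqnK integrable_tri))) => //.
  apply/measurable_EFinP; apply: measurable_funM => //.
  exact: measurable_funM.
move=> y _ /=; rewrite lee_fin normrM (ger0_norm (Ktri_ge0 y)).
apply: le_trans (ler_norm _).
rewrite (_ : M * _ = K y.1 * tri y.2 * (M * sqn y.1)); last ring.
by apply: ler_wpM2l; [exact: Ktri_ge0|exact: hessMsqn].
Qed.

(** Fubini with the integral over [s] inside, [v z] being its value. It is used at [h = 0], where
    the Hessian is constant in [s], and at [h > 0], where Taylor's formula gives the value. *)
Lemma integral_rem h x (v : MX -> R) :
  (forall z, \int[leb]_s (tri s * hess f (x - (s * h) *: z) z)%:E = (v z)%:E)%E ->
  \int[nu]_y (K y.1 * tri y.2 * rem h x y) = \int[mu]_z (K z * v z).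
Proof.
move=> vE; rewrite /Rintegral -integral12_prod_meas1; last exact: integrable_rem.
congr fine; apply: eq_integral => z _; rewrite /fubini_F /=.
rewrite EFinM -vE -integralZl//; last first.
  apply/integrableP; split.
    apply/measurable_EFinP; apply: measurable_funM; first exact: measurable_tri.
    exact: (measurableT_comp (mrem h x) (pair1_measurable z)).
  apply: (@le_lt_trans _ _ (\int[leb]_s ((M * sqn z)%:E * (tri s)%:E))%E); last first.
    by rewrite integralZl//; [rewrite integral_tri1 -EFinM ltry|exact: integrable_tri].
  apply: ge0_le_integral => //.
  - apply: measurableT_comp => //; apply/measurable_EFinP; apply: measurable_funM.
      exact: measurable_tri.
    exact: (measurableT_comp (mrem h x) (pair1_measurable z)).
  - apply: measurable_funeM; apply/measurable_EFinP; exact: measurable_tri.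
  move=> s _; rewrite -EFinM lee_fin normrM (ger0_norm (tri_ge0 s)) mulrC.
  by apply: ler_wpM2r; [exact: tri_ge0|exact: hessMsqn].
by apply: eq_integral => s _; rewrite /rem /= -mulrA EFinM.
Qed.

Lemma integral_rem0 x :
  \int[nu]_y (K y.1 * tri y.2 * rem 0 x y) = m2 / 2 * laplacian f x.
Proof.
rewrite (@integral_rem 0 x (fun z => 2^-1 * hess f x z)); last first.
  move=> z; under eq_integral do rewrite mulr0 scale0r subr0 EFinM.
  by rewrite integralZr//; [rewrite integral_tri1 -EFinM|exact: integrable_tri].
pose D (k : ('I_P * 'I_T) * ('I_P * 'I_T)) :=
  2^-1 * partial k.2.1 k.2.2 (partial k.1.1 k.1.2 f) x.
pose g (k : ('I_P * 'I_T) * ('I_P * 'I_T)) (z : MX) :=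
  z k.1.1 k.1.2 * z k.2.1 k.2.2 * K z.
have [_ gE] := @Rintegral_lincomb _ _ _ mu _ (index_enum _) D g (fun k => iK2 _ _ _ _).
transitivity (\int[mu]_z (\sum_k D k * g k z)).
  apply: eq_Rintegral => z _; rewrite hess_pairE !mulr_sumr.
  by apply: eq_bigr => k _; rewrite /D /g; ring.
rewrite gE /g; under eq_bigr do rewrite K2.
rewrite -(pair_bigA _ (fun i j => D (i, j) *
  (if (i.1 == j.1) && (i.2 == j.2) then m2 else 0))) /=.
rewrite /laplacian [in RHS]pair_bigA mulr_sumr; apply: eq_bigr => i _.
rewrite (bigD1 i) //= !eqxx big1 => [|j ji]; last first.
  by rewrite -xpair_eqE -!surjective_pairing eq_sym (negPf ji) mulr0.
by rewrite /D /=; ring.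
Qed.

Lemma integral_remh h x : 0 < h ->
  h ^+ 2 * \int[nu]_y (K y.1 * tri y.2 * rem h x y) = smooth f h K x - f x.
Proof.
move=> h0; have hN : h != 0 by rewrite gt_eqF.
(* Taylor's formula along [h *: z]. Its Hessian term is quadratic in the direction, so a factor
   [h ^+ 2] comes out. *)
pose v (z : MX) := h ^- 2 * (f (x - h *: z) - f x + grad f x (h *: z)).
rewrite (@integral_rem h x v); last first.
  move=> z; rewrite integral_tri /v EFinM -(taylor f2 f2c) -integralZl//; last first.
    exact: (integrable_remainder f2c).
  apply: eq_integral => s _; rewrite -EFinM scalerA hessZ; congr EFin.
  by field.
have [ig g0] := @Rintegral_lincomb _ _ _ mu _ (index_enum _)
  (fun k : 'I_P * 'I_T => partial k.1 k.2 f x)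
  (fun k z => z k.1 k.2 * K z) (fun k => iK1 _ _).
have gradE : (fun z : MX => \sum_(k : 'I_P * 'I_T)
    partial k.1 k.2 f x * (z k.1 k.2 * K z)) = (fun z : MX => K z * grad f x z).
  apply/funext => z; rewrite grad_pairE mulr_sumr.
  by apply: eq_bigr => k _; ring.
(* Since [K] is centered, the gradient term has integral zero. *)
rewrite gradE in ig g0; rewrite big1 in g0; last by move=> k _; rewrite KC mulr0.
have gradZ z : grad f x (h *: z) = h * grad f x z.
  rewrite /grad mulr_sumr; apply: eq_bigr => p _; rewrite mulr_sumr.
  by apply: eq_bigr => t _; rewrite !mxE mulrA.
have ismooth := integrable_smooth h mf f0 fB K0 iK x.
have i2 : mu.-integrable setT
    (EFin \o (fun z => K z * f (x - h *: z) - f x * K z)).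
  exact: (integrableB measurableT ismooth (integrableZl measurableT (f x) iK)).
have i3 : mu.-integrable setT (EFin \o (fun z =>
    K z * f (x - h *: z) - f x * K z + h * (K z * grad f x z))).
  exact: (integrableD measurableT i2 (integrableZl measurableT h ig)).
transitivity (\int[mu]_z (K z * f (x - h *: z) - f x * K z + h * (K z * grad f x z))).
  rewrite -RintegralZl//; last first.
    rewrite (_ : EFin \o _ = EFin \o (fun z => h ^- 2 *
      (K z * f (x - h *: z) - f x * K z + h * (K z * grad f x z)))).
      exact: (integrableZl measurableT (h ^- 2) i3).
    by apply/funext => z /=; congr EFin; rewrite /v gradZ; ring.
  by apply: eq_Rintegral => z _; rewrite /v gradZ; field.
rewrite RintegralD//; last exact: (integrableZl measurableT h ig).
rewrite RintegralB//; last exact: (integrableZl measurableT (f x) iK).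
by rewrite !RintegralZl// g0 K1 mulr0 addr0 mulr1.
Qed.

(** Separates the variables: a factor that is square integrable in [X] times a second moment weight
    in [V]. The uniform bound [hM] gives no integrability in [X]. *)
Lemma hess_le_tensor X V :
  `|hess f X V| <= (\sum_(k : ('I_P * 'I_T) * ('I_P * 'I_T))
    `|partial k.2.1 k.2.2 (partial k.1.1 k.1.2 f) X|) * sqn V.
Proof.
rewrite hess_pairE mulr_suml; apply: le_trans (ler_norm_sum _ _ _) _.
apply: ler_sum => k _; rewrite normrM mulrC ler_wpM2l//.
exact: normr_entryM_le_sqn.
Qed.

(* Cauchy-Schwarz would require fourth moments of [K] with the weight [K * tri]
   alone; the factor [1 + sqn] lets second moments suffice. *)
Let W (y : MX * RT) : R := K y.1 * tri y.2 / (1 + sqn y.1).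
Let cw (y : MX * RT) : R := K y.1 * tri y.2 * (1 + sqn y.1).
Let G (z : MX * (MX * RT)) : R := hess f z.1 z.2.1.

Let sqn1_gt0 V : 0 < 1 + sqn V.
Proof. by rewrite ltr_wpDr// sqn_ge0. Qed.

Let msqn1V : measurable_fun setT (fun y : MX * RT => (1 + sqn y.1)^-1).
Proof.
have mp : measurable_fun setT (fun y : MX * RT => (1 + sqn y.1) `^ (-1)).
  apply: (measurableT_comp (measurable_powR (-1))).
  exact: measurable_funD.
rewrite (_ : (fun _ => _) = fun y : MX * RT => (1 + sqn y.1) `^ (-1))//.
by apply/funext => y; rewrite powR_inv1// ltW.
Qed.

Let mW : measurable_fun setT W.
Proof. by apply: measurable_funM => //; exact: measurable_funM. Qed.

Let W0 y : 0 <= W y.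
Proof. by rewrite /W divr_ge0// ltW. Qed.

Let mG : measurable_fun setT G.
Proof.
apply: measurable_hess; first exact: measurable_fst.
by apply: (measurableT_comp (f := fst)); [exact: measurable_fst|exact: measurable_snd].
Qed.

Lemma weighted_hess_finite :
  (\int[mu \x mx_time]_z (W z.2 * G z ^+ 2)%:E < +oo)%E.
Proof.
pose D x := \sum_(k : ('I_P * 'I_T) * ('I_P * 'I_T))
    `|partial k.2.1 k.2.2 (partial k.1.1 k.1.2 f) x|.
have [mD iD] : square_summable mu D.
  by apply: square_summable_sum => k; apply: square_summable_normr; exact: f2s.
have isT : nu.-integrable setT (EFin \o (fun y => sqn y.1 * K y.1 * tri y.2)).
  exact: (integrable_tensor integrable_sqnK integrable_tri).
have iT := @integrable_tensor _ _ _ _ R mu mx_time (fun x => D x ^+ 2) _ iD isT.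
apply: le_lt_trans (integrable_lty measurableT iT) => //.
apply: ge0_le_integral => //.
- by move=> z _; rewrite lee_fin mulr_ge0// sqr_ge0.
- apply/measurable_EFinP; apply: measurable_funM.
    by apply: (measurableT_comp mW); exact: measurable_snd.
  exact: measurable_funX.
- exact: measurable_int iT.
move=> [x [v s]] _; rewrite lee_fin /W /G /=.
have S0 := sqn_ge0 v; have S1 := sqn1_gt0 v.
have H : hess f x v ^+ 2 <= (D x * sqn v) ^+ 2.
  rewrite -[hess _ _ _ ^+ 2]real_normK ?num_real// lerXn2r ?nnegrE//.
    by rewrite mulr_ge0//; apply: sumr_ge0.
  exact: hess_le_tensor.
have Kt := Ktri_ge0 (v, s); rewrite /= in Kt.
apply: (@le_trans _ _ (K v * tri s / (1 + sqn v) * (D x * sqn v) ^+ 2)).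
  by apply: ler_wpM2l H; rewrite divr_ge0// ltW.
(* The denominator [1 + sqn v] absorbs one of the two factors [sqn v], so that a second moment of
   [K] remains instead of a fourth. *)
rewrite (_ : K v * tri s / (1 + sqn v) * (D x * sqn v) ^+ 2 =
   K v * tri s * D x ^+ 2 * sqn v * (sqn v / (1 + sqn v))); last by field; rewrite gt_eqF.
rewrite (_ : D x ^+ 2 * (sqn v * K v * tri s) = K v * tri s * D x ^+ 2 * sqn v * 1); last ring.
apply: ler_wpM2l; first by rewrite mulr_ge0// mulr_ge0// sqr_ge0.
by rewrite ler_pdivrMr// mul1r lerDr.
Qed.

Lemma integrable_cw : nu.-integrable setT (EFin \o cw).
Proof.
rewrite (_ : EFin \o cw = (fun y => (K y.1 * tri y.2)%:E + (sqn y.1 * K y.1 * tri y.2)%:E)%E).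
  apply: integrableD => //; first exact: (integrable_tensor iK integrable_tri).
  exact: (integrable_tensor integrable_sqnK integrable_tri).
by apply/funext => y /=; rewrite -EFinD /cw; congr EFin; ring.
Qed.

Let weight_cancel (k t s a b : R) : 0 < 1 + s ->
  k * t * a - k * t * b = k * t * (1 + s) * ((a - b) / (1 + s)).
Proof. by move=> s0; field; rewrite gt_eqF. Qed.

Let weight_cancel2 (k t s a b : R) : 0 < 1 + s ->
  k * t * (1 + s) * ((a - b) / (1 + s)) ^+ 2 = k * t / (1 + s) * (a - b) ^+ 2.
Proof. by move=> s0; field; rewrite gt_eqF. Qed.

(** Chosen for Cauchy-Schwarz: [cw * gg] is the integrand of the remainder minus its value at
    [h = 0], and [cw * gg ^+ 2] is [W] times the squared difference of Hessians. *)
Let gg h x (y : MX * RT) : R := (rem h x y - rem 0 x y) / (1 + sqn y.1).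

Let mgg h x : measurable_fun setT (gg h x).
Proof.
have mr : measurable_fun setT (fun y => rem h x y - rem 0 x y).
  exact: measurable_funB (mrem h x) (mrem 0 x).
exact: measurable_funM mr msqn1V.
Qed.

Lemma bias_remainderE h x : 0 < h ->
  smooth f h K x - f x - h ^+ 2 * (m2 / 2 * laplacian f x) =
  h ^+ 2 * \int[nu]_y (cw y * gg h x y).
Proof.
move=> h0; rewrite -integral_remh// -integral_rem0 -mulrBr; congr (_ * _).
rewrite -RintegralB//; [|exact: integrable_rem|exact: integrable_rem].
apply: eq_Rintegral => y _; exact: weight_cancel (sqn1_gt0 y.1).
Qed.

(** At each [x], Cauchy-Schwarz bounds the squared error by [h ^+ 4 * A] times a weighted integral
    of [(f''(x - t h Z)(Z, Z) - f''(x)(Z, Z)) ^+ 2]. Integrated over [x], this is the L^2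
    translation error of the Hessian, eventually below [e / A]. *)
Lemma bias_asymptotics (h : nat -> R) (e : R) : (forall N, 0 < h N) ->
  h @ \oo --> 0 -> 0 < e -> \forall N \near \oo,
  (\int[mu]_x ((smooth f (h N) K x - f x - h N ^+ 2 * (m2 / 2 * laplacian f x)) ^+ 2)%:E
   <= (h N ^+ 4 * e)%:E)%E.
Proof.
move=> h0 hcvg e0.
(* The [+ 1] makes [A] visibly positive. *)
pose A := \int[nu]_y cw y + 1.
have cw0 y : 0 <= cw y by rewrite mulr_ge0// ltW.
have A0 : 0 < A by rewrite ltr_wpDl//; exact: Rintegral_ge0.
have cwA : (\int[nu]_y (cw y)%:E <= A%:E)%E.
  rewrite -[leLHS]fineK; last exact: integrable_fin_num integrable_cw.
  by rewrite lee_fin /A lerDl.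
pose tau k (y : MX * RT) : MX := (y.2 * h k) *: y.1.
have mtau k : measurable_fun setT (tau k).
  apply: measurable_mxZ; last exact: measurable_fst.
  by apply: measurable_funM => //; exact: measurable_snd.
have tau0 y : tau ^~ y @ \oo --> (0 : MX).
  exact: (@cvg_scale0 R MX).
have cG y : continuous (fun x => G (x, y)) by exact: continuous_hess.
have eA : 0 < e / A by rewrite divr_gt0.
have := @L2_translation_cvg R P T _ _ mx_time W G tau W0 mW mG mtau cG tau0 (e / A)
  weighted_hess_finite eA.
apply: filterS => k Hk.
have mcw := integrable_measurable integrable_cw.
have mWG : measurable_fun setT (fun z : MX * (MX * RT) =>
    (W z.2 * (G (z.1 - tau k z.2, z.2) - G z) ^+ 2)%:E).
  apply/measurable_EFinP; apply: measurable_funM.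
    by apply: (measurableT_comp mW); exact: measurable_snd.
  have ms : measurable_fun setT (fun z : MX * (MX * RT) => G (z.1 - tau k z.2, z.2)).
    exact: (measurable_shift mG mtau k).
  exact: (measurable_funX 2 (measurable_funB ms mG)).
have WG0 z : (0 <= (W z.2 * (G (z.1 - tau k z.2, z.2) - G z) ^+ 2)%:E)%E.
  by rewrite lee_fin mulr_ge0// sqr_ge0.
rewrite (fubini_tonelli1 _ mWG WG0) in Hk.
have c0 : (0 <= (h k ^+ 4 * A)%:E)%E by rewrite lee_fin mulr_ge0 ?exprn_ge0// ltW.
apply: (@le_trans _ _ ((h k ^+ 4 * A)%:E * (e / A)%:E)%E); last first.
  rewrite -EFinM lee_fin le_eqVlt; apply/orP; left; apply/eqP; field.
  by rewrite gt_eqF.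
apply: le_trans (lee_wpmul2l c0 (ltW Hk)).
rewrite -ge0_integralZl//; last 2 first.
- exact: measurable_fun_fubini_tonelli_F.
- by move=> x _; apply: integral_ge0.
apply: ge0_le_integral => //.
- by move=> x _; rewrite lee_fin sqr_ge0.
- apply/measurable_EFinP; apply: measurable_funX; apply: measurable_funB.
    by apply: measurable_funB => //; exact: measurable_smooth.
  apply: measurable_funM => //; apply: measurable_funM => //.
  do 2![apply: measurable_sum => ?]; exact: (f2s _ _ _ _).1.
- by apply: measurable_funeM; exact: measurable_fun_fubini_tonelli_F.
move=> x _; rewrite bias_remainderE// exprMn -exprM EFinM [in leRHS]EFinM -muleA.
apply: lee_wpmul2l; first by rewrite lee_fin exprn_ge0// ltW.
apply: le_trans (weighted_cauchy_schwarz A0 cw0 mcw (mgg (h k) x) cwA) _.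
apply: lee_wpmul2l; first by rewrite lee_fin ltW.
rewrite le_eqVlt; apply/orP; left; apply/eqP; apply: eq_integral => y _.
congr EFin; rewrite /cw /gg /W /G /rem /tau /=.
rewrite mulr0 scale0r subr0; exact: weight_cancel2 (sqn1_gt0 y.1).
Qed.

End bias.

(** * Error terms and conclusion *)

Lemma normr_Rintegral_sqrB d (S : measurableType d) (R : realType)
    (nu : {measure set S -> \bar R}) (b g : S -> R) (t : R) :
  square_summable nu b -> square_summable nu g -> 0 < t ->
  `|\int[nu]_x (b x ^+ 2) - \int[nu]_x (g x ^+ 2)| <=
  (1 + t^-1) * \int[nu]_x ((b x - g x) ^+ 2) + t * \int[nu]_x (g x ^+ 2).
Proof.
move=> sb sg t0; have [mb ib] := sb; have [mg ig] := sg.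
have sNg : square_summable nu (fun x => - g x).
  by split; [exact: measurable_funN|under eq_fun do rewrite sqrrN].
have [_ ibg] := square_summableD sb sNg.
have i1 : nu.-integrable setT
    (EFin \o (fun x => (1 + t^-1) * (b x - g x) ^+ 2)).
  exact: (integrableZl measurableT (1 + t^-1) ibg).
have i2 : nu.-integrable setT (EFin \o (fun x => t * g x ^+ 2)).
  exact: (integrableZl measurableT t ig).
have iB : nu.-integrable setT (EFin \o (fun x => b x ^+ 2 - g x ^+ 2)).
  exact: (integrableB measurableT ib ig).
rewrite -RintegralB// -RintegralZl// -RintegralZl// -RintegralD//.
apply: le_trans (le_normr_Rintegral measurableT iB) _.
apply: le_Rintegral => //.
- exact: integrable_norm iB.
- exact: (integrableD measurableT i1 i2).
move=> x _; set u := b x; set v := g x.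
(* Pointwise, [u ^+ 2 - v ^+ 2] is [(u - v) ^+ 2] plus a cross term, which Young's inequality with
   parameter [t] splits. *)
rewrite -[X in _ <= X](_ : (u - v) ^+ 2 + (t^-1 * (u - v) ^+ 2 + t * v ^+ 2) = _); last ring.
rewrite (_ : u ^+ 2 - v ^+ 2 = (u - v) ^+ 2 + 2 * (u - v) * v); last ring.
apply: le_trans (ler_normD _ _) _; rewrite (ger0_norm (sqr_ge0 _)) lerD2l.
(* Completing the square for both signs of the cross term at once: at [s = 1] and [s = -1] the last
   summand vanishes. *)
have E s : t^-1 * (u - v) ^+ 2 + t * v ^+ 2 - s * (2 * (u - v) * v) =
    t^-1 * (u - v - s * t * v) ^+ 2 + (1 - s ^+ 2) * (t * v ^+ 2).
  by field; rewrite gt_eqF.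
have tV : 0 <= t^-1 by rewrite invr_ge0 ltW.
rewrite ler_norml -subr_ge0 opprK -[X in _ && X]subr_ge0; apply/andP; split.
  rewrite [X in 0 <= X](_ : _ = t^-1 * (u - v - -1 * t * v) ^+ 2).
    by rewrite mulr_ge0// sqr_ge0.
  have := E (-1); rewrite sqrrN expr1n subrr mul0r addr0 => <-; ring.
rewrite [X in 0 <= X](_ : _ = t^-1 * (u - v - 1 * t * v) ^+ 2).
  by rewrite mulr_ge0// sqr_ge0.
have := E 1; rewrite expr1n subrr mul0r addr0 => <-; ring.
Qed.

(** Up to sign, the quotient of the two sequences is [h N ^+ n * I N], at most [(C + 1) * h N] once
    [h N <= 1]. The [+ 1] keeps the constant positive when [C = 0]. *)
Lemma littleo_of_bounded (R : realType) (n : nat) (h I : nat -> R) (C : R) :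
  (0 < n)%N -> (forall N, 0 < h N) -> h @ \oo --> 0 ->
  (forall N, 0 <= I N) -> (forall N, I N <= C) ->
  (fun N => - (N%:R^-1 * I N)) =o_\oo (fun N => N%:R^-1 * h N ^- n).
Proof.
move=> n0 h0 hcvg I0 IC; apply/eqoP => e e0.
have C0 : 0 < C + 1 by rewrite ltr_wpDl//; exact: le_trans (I0 0%N) (IC 0%N).
have m0 : 0 < Num.min 1 (e / (C + 1)).
  by rewrite lt_min ltr01 divr_gt0.
move/cvgrPdist_lt : hcvg => /(_ _ m0); apply: filterS => N.
rewrite sub0r normrN gtr0_norm// lt_min => /andP[h1 he].
have Ni0 : 0 <= (N%:R^-1 : R) by rewrite invr_ge0.
have hn0 : 0 < h N ^+ n by rewrite exprn_gt0.
rewrite normrN (ger0_norm (mulr_ge0 Ni0 (I0 N))).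
rewrite ger0_norm; last by rewrite mulr_ge0// invr_ge0 ltW.
rewrite mulrCA; apply: ler_wpM2l => //.
rewrite ler_pdivlMr//.
have hnh : h N ^+ n <= h N.
  rewrite -[leRHS]expr1; apply: ler_wiXn2l => //; exact: ltW.
apply: (@le_trans _ _ ((C + 1) * h N)).
  apply: ler_pM => //; first exact: ltW.
  by apply: le_trans (IC N) _; rewrite lerDl.
by rewrite mulrC -ler_pdivlMr// ltW.
Qed.

Section assembly.
Context {R : realType} {P T : nat}.
Local Notation MX := 'M[R]_(P, T).
Local Notation mu := (@lebesgue_mx R P T).

Lemma square_integrable_summable (a : MX -> R) :
  square_integrable a -> square_summable mu a.
Proof.
move=> a2; split; last exact: Lfun2_integrable_sqr.
by move: a2; rewrite /square_integrable inE => /andP[]; rewrite inE.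
Qed.

Lemma square_summable_laplacian (f : MX -> R) :
  (forall p t q s, square_summable mu (partial q s (partial p t f))) ->
  square_summable mu (laplacian f).
Proof. by move=> f2s; do 2![apply: square_summable_sum => ?]. Qed.

Lemma continuous_laplacian (f : MX -> R) :
  (forall p t q s, continuous (partial q s (partial p t f))) ->
  continuous (laplacian f).
Proof.
move=> f2c; apply: continuous_sum => p; apply: continuous_sum => t; exact: f2c.
Qed.

Lemma mxvec_index_eq m n (i j : 'I_m) (k l : 'I_n) :
  (mxvec_index i k == mxvec_index j l) = (i == j) && (k == l).
Proof.
by rewrite /mxvec_index (inj_eq (@cast_ord_inj _ _ _)) (inj_eq enum_rank_inj).
Qed.

(** [vec] flattens the transpose row by row, so the entry [X p t] sits at position
    [mxvec_index t p], with its indices swapped. *)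
Lemma isotropic_moment (K : MX -> R) (m2 : R) p t q s :
  isotropic_second_moment K m2 ->
  mu.-integrable setT (fun X => (X p t * X q s * K X)%:E) /\
  \int[mu]_X (X p t * X q s * K X) = if (p == q) && (t == s) then m2 else 0.
Proof.
move=> [iK /matrixP E _].
have vE (X : MX) :
    (vec X *m (vec X)^T) (mxvec_index t p) (mxvec_index s q) = X p t * X q s.
  by rewrite mxE big_ord1 /vec !mxE !mxvecE !mxE.
split.
  rewrite (_ : (fun _ => _) = fun X : MX => ((vec X *m (vec X)^T)
    (mxvec_index t p) (mxvec_index s q) * K X)%:E) //.
  by apply/funext => X; rewrite vE.
have := E (mxvec_index t p) (mxvec_index s q).
rewrite [LHS]mxE [RHS]mxE mxvec_index_eq andbC => EE.
have -> : (if (p == q) && (t == s) then m2 else 0) = m2 *+ ((p == q) && (t == s)).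
  by case: ifP; rewrite ?mulr1n ?mulr0n.
by rewrite -EE; apply: eq_Rintegral => X _; rewrite vE.
Qed.

Variables (K : MX -> R).
Hypothesis K0 : forall X, 0 <= K X.
Hypothesis iK : mu.-integrable setT (EFin \o K).
Hypothesis K1 : \int[mu]_X K X = 1.

Let intK_neq0 : (\int[mu]_X (K X)%:E)%E != 0.
Proof.
apply/eqP => E; have := K1; rewrite /Rintegral E /= => /esym/eqP.
by rewrite oner_eq0.
Qed.

Lemma roughness_kernel_gt0 : mu.-integrable setT (fun X => (K X ^+ 2)%:E) ->
  0 < roughness K.
Proof.
move=> iK2; apply: (Rintegral_gt0 (G := K)) => //.
- exact: integrable_measurable iK.
- by move=> X; exact: sqr_ge0.
- by apply: aeW => X /eqP; rewrite sqrf_eq0 => /eqP.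
Qed.

(** Where [X p t * X p t * K X] vanishes, so does [K X], except on the hyperplane [X p t = 0], which
    is Lebesgue null and cannot carry the mass of [K]. *)
Lemma second_moment_gt0 (m2 : R) (p : 'I_P) (t : 'I_T) :
  isotropic_second_moment K m2 -> 0 < m2.
Proof.
move=> iso; have [iF E] := isotropic_moment p t p t iso.
rewrite !eqxx/= in E; rewrite -E.
apply: (Rintegral_gt0 (G := K)) => //.
- exact: integrable_measurable iK.
- by move=> X; rewrite mulr_ge0// -expr2 sqr_ge0.
exists [set X : MX | X p t = 0]; split.
- have := measurable_entry p t measurableT (measurable_set1 (0 : R)).
  by rewrite setTI.
- exact: lebesgue_mx_coord_hyperplane.
move=> X /= /not_implyP[/eqP]; rewrite mulf_eq0 -expr2 sqrf_eq0.
by case/orP => /eqP.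
Qed.

End assembly.

Theorem proposition1 (R : realType) (P T : nat) (P_gt0 : (0 < P)%N)
    (T_gt0 : (0 < T)%N)
    (d : measure_display) (Omega : measurableType d) (Pr : probability Omega R)
    (X : nat -> {RV Pr >-> 'M[R]_(P, T)}) (f K : 'M[R]_(P, T) -> R) (m2 : R)
    (h : nat -> R)
    (X_indep : mutually_independent X)
    (X_density : forall n, has_density (@lebesgue_mx R P T) (X n) f)
    (K_kernel : is_kernel K)
    (K_centered : centered K)
    (f_L2 : square_integrable f)
    (f_diff2 : twice_differentiable f)
    (f_partial2 : forall p t q s,
       [/\ [bounded partial q s (partial p t f) x | x in setT],
           continuous (partial q s (partial p t f)) &
           square_integrable (partial q s (partial p t f))])
    (K_L2 : square_integrable K)
    (K_moment2 : isotropic_second_moment K m2)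
    (h_gt0 : forall N, 0 < h N)
    (h_cvg0 : h @ \oo --> 0)
    (Nh_cvg0 : (fun N => N%:R^-1 * h N ^- (P * T)) @ \oo --> 0) :
  (exists e1 e2 : nat -> R,
     [/\ e1 =o_\oo (fun N => N%:R^-1 * h N ^- (P * T)),
         e2 =o_\oo (fun N => h N ^+ 4) &
         forall N, (0 < N)%N ->
           MISE K X N (h N) f = (AMISE K f m2 N (h N) + e1 N + e2 N)%:E]) /\
  (forall N, (0 < N)%N ->
     0 < h_AMISE K f m2 N /\
     forall h' : R, 0 < h' ->
       AMISE K f m2 N (h_AMISE K f m2 N) <= AMISE K f m2 N h').
Proof.
have PT_gt0 : (0 < P * T)%N by rewrite muln_gt0 P_gt0.
have [mf f0 fE] := X_density 0%N; have [K0 iK K1] := K_kernel.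
have [_ iK2] := square_integrable_summable K_L2.
have [_ if2] := square_integrable_summable f_L2.
have f2c p t q s : continuous (partial q s (partial p t f)).
  by have [] := f_partial2 p t q s.
have f2s p t q s :
    square_summable (@lebesgue_mx R P T) (partial q s (partial p t f)).
  by apply: square_integrable_summable; have [] := f_partial2 p t q s.
have [M M0 hM] : exists2 M : R, 0 < M &
    forall Y V, `|hess f Y V| <= M * `|V| ^+ 2.
  by apply: hess_bound => p t q s; have [] := f_partial2 p t q s.
have law1 : distribution Pr (X 0%N) setT = 1%E by exact: probability_setT.
have fB := density_bounded f_diff2 f2c M0 hM mf f0 fE law1.
have [Y0 lap0] := laplacian_neq0 f_diff2 f2c M0 hM mf f0 fE law1 P_gt0 T_gt0.
have [mlap ilap] := square_summable_laplacian f2s.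
have RL0 : 0 < roughness (laplacian f).
  exact: roughness_gt0 mlap ilap (continuous_laplacian f2c) lap0.
have RK0 : 0 < roughness K := roughness_kernel_gt0 iK K1 iK2.
have m20 : 0 < m2.
  exact: (second_moment_gt0 K0 iK K1 (Ordinal P_gt0) (Ordinal T_gt0)).
split; last first.
  by move=> N N0; split; [exact: h_AMISE_gt0|move=> h' h'0; exact: AMISE_h_AMISE_le].
have bias := bias_asymptotics f_diff2 f2c f2s M0 hM mf f0 fB K0 iK K1
  (fun p t => (K_centered p t).1) (fun p t => (K_centered p t).2)
  (fun p t q s => (isotropic_moment p t q s K_moment2).1)
  (fun p t q s => (isotropic_moment p t q s K_moment2).2) h_gt0 h_cvg0.
pose mu := @lebesgue_mx R P T.
pose sm N := \int[mu]_x (smooth f (h N) K x ^+ 2).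
pose sb N := \int[mu]_x ((smooth f (h N) K x - f x) ^+ 2).
pose g N x := h N ^+ 2 * (m2 / 2 * laplacian f x).
have gE N : \int[mu]_x (g N x ^+ 2) =
    4^-1 * h N ^+ 4 * m2 ^+ 2 * roughness (laplacian f).
  rewrite /roughness -RintegralZl//; apply: eq_Rintegral => x _.
  by rewrite /g; field.
(* The decomposition of the MISE is exact, so both errors are explicit: the part of the variance
   left out of the AMISE, and the gap between the integrated squared bias and that of its leading
   term [g N]. *)
exists (fun N => - (N%:R^-1 * sm N)).
exists (fun N => sb N - \int[mu]_x (g N x ^+ 2)); split.
- apply: (@littleo_of_bounded R _ h sm (roughness f)) => // N.
    by apply: Rintegral_ge0 => x _; exact: sqr_ge0.
  rewrite -lee_fin /sm /Rintegral fineK.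
    exact: (smooth_sqr_le (h N) X_density K0 iK if2 K1).
  apply: (integrable_fin_num measurableT).
  exact: (integrable_smooth_sqr (h N) X_density K0 iK if2 K1).
- apply/eqoP => e e0.
  pose c := 4^-1 * m2 ^+ 2 * roughness (laplacian f).
  have c0 : 0 < c by rewrite !mulr_gt0// ?exprn_gt0// invr_gt0.
  (* The tolerance [e] is halved: one half for [t] times the integral of [g N x ^+ 2], which equals
     [h N ^+ 4 * c], the other for [1 + t^-1] times the squared L^2 distance between the bias and
     [g N]. *)
  pose t := e / (2 * c).
  have t0 : 0 < t by rewrite divr_gt0// mulr_gt0.
  have t1 : 0 < 1 + t^-1 by rewrite addr_gt0// invr_gt0.
  have e'0 : 0 < e / (2 * (1 + t^-1)) by rewrite divr_gt0// mulr_gt0.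
  apply: filterS (bias _ e'0) => N HN.
  have h4 : 0 < h N ^+ 4 by rewrite exprn_gt0.
  rewrite (gtr0_norm h4).
  have sbs : square_summable mu (fun x => smooth f (h N) K x - f x).
    split; last exact: (integrable_bias_sqr (h N) X_density K0 iK if2 K1).
    exact: (measurable_funB (measurable_smooth (h N) mf f0 K0 iK) mf).
  have sg : square_summable mu (g N).
    split; first by apply: measurable_funM => //; exact: measurable_funM.
    rewrite (_ : (fun _ => _) = fun x => ((h N ^+ 4 * (m2 / 2) ^+ 2)%:E *
      (laplacian f x ^+ 2)%:E)%E); first exact: integrableZl.
    by apply/funext => x; rewrite -EFinM; congr EFin; rewrite /g; ring.
  apply: le_trans (normr_Rintegral_sqrB sbs sg t0) _.
  have DN : \int[mu]_x ((smooth f (h N) K x - f x - g N x) ^+ 2) <=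
      h N ^+ 4 * (e / (2 * (1 + t^-1))).
    have sNg : square_summable mu (fun x => - g N x).
      have [mg ig] := sg.
      by split; [exact: measurable_funN|under eq_fun do rewrite sqrrN].
    have [_ iD] := square_summableD sbs sNg.
    by rewrite -lee_fin /Rintegral fineK// (integrable_fin_num measurableT).
  apply: (@le_trans _ _ ((1 + t^-1) * (h N ^+ 4 * (e / (2 * (1 + t^-1)))) +
      t * (h N ^+ 4 * c))).
    apply: lerD; first by apply: ler_wpM2l DN; exact: ltW.
    by rewrite gE /c le_eqVlt; apply/orP; left; apply/eqP; ring.
  rewrite le_eqVlt; apply/orP; left; apply/eqP.
  have tc : t * c = e / 2 by rewrite /t; field; rewrite gt_eqF.
  rewrite [t * _]mulrCA tc.
  have cancel w : w != 0 -> w * (h N ^+ 4 * (e / (2 * w))) = h N ^+ 4 * (e / 2).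
    by move=> w0; field.
  by rewrite cancel ?gt_eqF//; field.
- move=> N N0; rewrite (MISE_decomposition X_indep X_density fB (h_gt0 N) N0 K0
    iK iK2 if2 K1); congr EFin.
  by rewrite -/(sm N) -/(sb N) gE /AMISE; ring.
Qed.
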